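(* Let $\mathfrak C$ be a monster model of a complete theory in a countable language. Let $X$ be a type-definable, countably supported set, let $E$ be a bounded, $F_\sigma$ equivalence relation on $X$ which is orbital on types, let $Y\subseteq X$ be a pseudo-closed and $E$-saturated set, and let $C\subseteq Y$ be an $E$-class which has infinite diameter with respect to some normal form of $E$. Then $E\restriction_Y$ is not smooth.
   Context: Conventions: the theory $T$ is complete with infinite models (possibly multi-sorted), and $\mathfrak C$ is a monster model: $\kappa$-saturated and strongly $\kappa$-homogeneous for a sufficiently large cardinal $\kappa$. ''Small'' and ''bounded'' mean of cardinality $<\kappa$. Parameter sets are small subsets of $\mathfrak C$; models are elementary substructures of $\mathfrak C$; tuples have small length; sets such as $X$ are subsets of products of sorts of $\mathfrak C$. ''Definable'', ''type-definable'', ''invariant'' mean without parameters unless stated otherwise; $A$-invariant means $\mathrm{Aut}(\mathfrak C/A)$-invariant. A set is countably supported if it is contained in a product of countably many sorts. An equivalence relation is bounded if it has a bounded number of classes. For an $A$-invariant set $Z$ put $Z_A=\{\mathrm{tp}(a/A): a\in Z\}\subseteq S(A)$. An invariant set is $F_\sigma$ if the corresponding subset of $S(\emptyset)$ is $F_\sigma$ (an equivalence relation on $X$ is regarded as a subset of $X^2$). A set is pseudo-closed if it is type-definable with parameters from some small set. $Y\subseteq X$ is $E$-saturated if it contains every $E$-class it intersects. Normal form: a disjunction $\bigvee_{n\in\mathbf N}\Phi_n(x,y)$ of partial types (over $\emptyset$) on the type-definable set $X$, with $\Phi_0(x,y)=((x=y)\wedge x\in X)$ and $\Phi_n\vdash\Phi_{n+1}$,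 is a normal form for $E$ if for all $a,b\in X$: $a\mathrel{E}b$ iff some $\Phi_n(a,b)$ holds, and $d(a,b)=\min\{n:\ \models\Phi_n(a,b)\}$ (with $\min\emptyset=\infty$) is a metric on $X$ with values in $\mathbf N\cup\{\infty\}$ (coincidence, symmetry, triangle inequality). The diameter of a nonempty subset of $X$ with respect to the normal form is the supremum of $d$-distances between its points. Orbital: an invariant equivalence relation $E$ on $X$ is orbital if there is a group $\Gamma\le\mathrm{Aut}(\mathfrak C)$ which preserves each class of $E$ setwise and acts transitively on each class. $E$ refines type if $a\mathrel{E}b$ implies $\mathrm{tp}(a/\emptyset)=\mathrm{tp}(b/\emptyset)$. $E$ is orbital on types if it refines type and the restriction of $E$ to (the realisations of) any complete $\emptyset$-type in $X$ is orbital. Smoothness: for a model $M$, $E^M$ is the equivalence relation on $S_X(M)=X_M$ given by $p\mathrel{E^M}q$ iff there are $a\models p$, $b\models q$ with $a\mathrel{E}b$ (equivalently, for all such $a,b$). For $Y$ pseudo-closed and $E$-saturated, $E\restriction_Y$ is smooth if for a countable model $M$ (equivalently, for every one) $E^M\restriction_{Y_M}$ is a smooth Borel equivalence relation on the Polish space $Y_M$, i.e. it is Borel reducible to equality on a Polish space. *)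

(* Defs.v *)
From HB Require Import structures.
From mathcomp Require Import all_boot all_order all_algebra.
From mathcomp Require Import all_classical all_reals all_analysis borel_hierarchy.

Set Implicit Arguments.
Unset Strict Implicit.
Unset Printing Implicit Defensive.

Local Open Scope classical_set_scope.
Local Open Scope card_scope.

Record language := Language {
  lsort : Type;
  fun_sym : Type;
  fun_arity : fun_sym -> nat;
  fun_dom : forall f, 'I_(fun_arity f) -> lsort;
  fun_cod : fun_sym -> lsort;
  rel_sym : Type;
  rel_arity : rel_sym -> nat;
  rel_dom : forall r, 'I_(rel_arity r) -> lsort
}.
Arguments fun_dom {l} f k.
Arguments fun_cod {l} f.
Arguments rel_dom {l} r k.

Definition countable_language (L : language) : Prop :=
  [/\ countable [set: lsort L], countable [set: fun_sym L]
    & countable [set: rel_sym L]].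

Record structure (L : language) := Structure {
  carrier :> lsort L -> Type;
  carrier_inhabited : forall s, inhabited (carrier s);
  fun_int : forall f : fun_sym L,
    (forall k, carrier (fun_dom f k)) -> carrier (fun_cod f);
  rel_int : forall r : rel_sym L, (forall k, carrier (rel_dom r k)) -> Prop
}.
Arguments fun_int {L} N f args : rename.
Arguments rel_int {L} N r args : rename.

(* The free variables of a term or formula are the elements of an arbitrary
   type [I], the variable [i] having sort [sg i].  A quantifier over the sort
   [s] adds one variable: its body lives over [option I], with [None] bound. *)

Inductive term (L : language) (I : Type) (sg : I -> lsort L) : lsort L -> Type :=
| Var (i : I) : term sg (sg i)
| App (f : fun_sym L) (args : forall k, term sg (fun_dom f k)) :
    term sg (fun_cod f).

Definition ext_sort (L : language) (I : Type) (sg : I -> lsort L) (s : lsort L) :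
    option I -> lsort L :=
  fun o => if o is Some i then sg i else s.

Inductive formula (L : language) (I : Type) (sg : I -> lsort L) : Type :=
| Fals : formula sg
| Eq (s : lsort L) (t u : term sg s) : formula sg
| Rel (r : rel_sym L) (args : forall k, term sg (rel_dom r k)) : formula sg
| Imp (phi psi : formula sg) : formula sg
| All (s : lsort L) (phi : formula (ext_sort sg s)) : formula sg.
Arguments Fals {L I sg}.

Definition Neg (L : language) (I : Type) (sg : I -> lsort L) (phi : formula sg)
  : formula sg := Imp phi Fals.

Section Semantics.
Context {L : language} (N : structure L).

(* The product of the sorts [sg i] of [N]. *)
Definition tup (I : Type) (sg : I -> lsort L) : Type := forall i, N (sg i).

Definition ext_tup (I : Type) (sg : I -> lsort L) (a : tup sg) (s : lsort L)
    (x : N s) : tup (ext_sort sg s) :=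
  fun o => match o with Some i => a i | None => x end.

Fixpoint eval (I : Type) (sg : I -> lsort L) (a : tup sg) (s : lsort L)
    (t : term sg s) : N s :=
  match t with
  | Var i => a i
  | App f args => fun_int N f (fun k => eval a (args k))
  end.

Fixpoint sat (I : Type) (sg : I -> lsort L) (a : tup sg) (phi : formula sg)
    : Prop :=
  match phi with
  | Fals => False
  | Eq s t u => eval a t = eval a u
  | Rel r args => rel_int N r (fun k => eval a (args k))
  | Imp phi psi => sat a phi -> sat a psi
  | All s phi => forall x : N s, sat (ext_tup a x) phi
  end.

Definition elt : Type := {s : lsort L & N s}.

End Semantics.

Definition sentence (L : language) : Type := formula (of_void (lsort L)).

Definition models (L : language) (N : structure L) (phi : sentence L) : Prop :=
  sat (fun i : void => match i with end : N (of_void (lsort L) i)) phi.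

Definition model_of (L : language) (T : set (sentence L)) (N : structure L)
  : Prop := forall phi, T phi -> models N phi.

Definition complete_theory (L : language) (T : set (sentence L)) : Prop :=
  (exists N, model_of T N) /\
  forall phi, (forall N, model_of T N -> models N phi) \/
              (forall N, model_of T N -> models N (Neg phi)).

Definition has_infinite_model (L : language) (T : set (sentence L)) : Prop :=
  exists2 N, model_of T N & infinite_set [set: elt N].

Definition card_lt (T U : Type) (A : set T) (B : set U) : Prop :=
  A #<= B /\ ~ (B #<= A).

Section Monster.
Context {L : language} (C : structure L).

Section Tuples.
Context {I : Type} {sg : I -> lsort L}.

Definition sum_sort {J : Type} (tg : J -> lsort L) : I + J -> lsort L :=
  fun x => match x with inl i => sg i | inr j => tg j end.

Definition pair_tup {J : Type} {tg : J -> lsort L} (a : tup C sg)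
    (b : tup C tg) : tup C (sum_sort tg) :=
  fun x => match x with inl i => a i | inr j => b j end.

Definition act (f : forall s, C s -> C s) (a : tup C sg) : tup C sg :=
  fun i => f (sg i) (a i).

End Tuples.
Arguments sum_sort {I} sg {J} tg.

Definition par_sort (A : set (elt C)) : A -> lsort L :=
  fun c => projT1 (sval c).

Definition par_tup (A : set (elt C)) : tup C (@par_sort A) :=
  fun c => projT2 (sval c).

Definition formula_over (A : set (elt C)) (I : Type) (sg : I -> lsort L) :=
  formula (sum_sort sg (@par_sort A)).

Section Types.
Context {I : Type} {sg : I -> lsort L} {A : set (elt C)}.

Definition holds (a : tup C sg) (phi : formula_over A sg) : Prop :=
  sat (pair_tup a (@par_tup A)) phi.

Definition solutions (Phi : set (formula_over A sg)) : set (tup C sg) :=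
  [set a | forall phi, Phi phi -> holds a phi].

Definition fin_sat (Phi : set (formula_over A sg)) : Prop :=
  forall F, finite_set F -> F `<=` Phi -> solutions F !=set0.

Definition is_complete_type (p : set (formula_over A sg)) : Prop :=
  fin_sat p /\ forall phi, p phi \/ p (Neg phi).

End Types.

Record ctype (A : set (elt C)) (I : Type) (sg : I -> lsort L) := CType {
  ctype_set : set (formula_over A sg);
  ctypeP : is_complete_type ctype_set
}.

HB.instance Definition _ A I (sg : I -> lsort L) :=
  gen_eqMixin (ctype A sg).
HB.instance Definition _ A I (sg : I -> lsort L) :=
  gen_choiceMixin (ctype A sg).
HB.instance Definition _ A I (sg : I -> lsort L) :=
  isSubBaseTopological.Build (ctype A sg)
    [set U | exists phi, U = [set p : ctype A sg | ctype_set p phi]] id.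

Section TypeSpaces.
Context {I : Type} {sg : I -> lsort L}.
Implicit Types (A : set (elt C)) (X Y Z : set (tup C sg)).

Lemma tp_subproof A (a : tup C sg) :
  is_complete_type [set phi : formula_over A sg | holds a phi].
Proof.
split=> [F _ FP|phi]; first by exists a => phi /FP.
by case: (pselect (holds a phi)) => H; [left | right => /H].
Qed.

Definition tp A (a : tup C sg) : ctype A sg := CType (tp_subproof A a).

(* [Z_A]; meant for [A]-invariant [Z]. *)
Definition types_of A Z : set (ctype A sg) := tp A @` Z.

Definition type_definable_over A X : Prop :=
  exists Phi : set (formula_over A sg), X = solutions Phi.

Definition type_definable X : Prop := type_definable_over set0 X.

End TypeSpaces.
Arguments types_of {I sg} A Z.

Definition automorphism (f : forall s, C s -> C s) : Prop :=
  [/\ forall s, bijective (f s),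
      forall g args, f _ (fun_int C g args) = fun_int C g (act f args)
    & forall r args, rel_int C r args <-> rel_int C r (act f args)].

Definition aut_group (G : set (forall s, C s -> C s)) : Prop :=
  [/\ G `<=` automorphism,
      G (fun s => id),
      forall f g, G f -> G g -> G (fun s => f s \o g s)
    & forall f g, G f -> (forall s, cancel (f s) (g s)) ->
                  (forall s, cancel (g s) (f s)) -> G g].

(* A cardinal is given by a type [K] of that cardinality. *)

Definition small (K T : Type) (A : set T) : Prop := card_lt A [set: K].

Definition saturated (K : Type) : Prop :=
  forall (A : set (elt C)) (s : lsort L)
         (Phi : set (formula_over A (fun _ : unit => s))),
    small K A -> fin_sat Phi -> solutions Phi !=set0.

Definition strongly_homogeneous (K : Type) : Prop :=
  forall (J : Type) (tg : J -> lsort L) (a b : tup C tg),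
    small K [set: J] -> tp set0 a = tp set0 b ->
    exists2 f, automorphism f & act f a = b.

(* For a countable language, [2 ^ aleph_0 < K] is what ``sufficiently large''
   is taken to mean. *)
Definition monster (K : Type) : Prop :=
  [/\ card_lt [set: set nat] [set: K], saturated K & strongly_homogeneous K].

Definition elementary (N : structure L) (j : forall s, N s -> C s) : Prop :=
  forall (J : Type) (tg : J -> lsort L) (a : tup N tg) (phi : formula tg),
    sat a phi <-> sat (fun i => j _ (a i) : C (tg i)) phi.

(* [M] is the universe of an elementary substructure, presented as the image
   of an elementary embedding. *)
Definition elementary_submodel (M : set (elt C)) : Prop :=
  exists (N : structure L) (j : forall s, N s -> C s),
    elementary j /\
    M = [set existT _ (projT1 x) (j _ (projT2 x)) | x in [set: elt N]].

Section Relations.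
Context {I : Type} {sg : I -> lsort L}.
Implicit Types (X Y Z : set (tup C sg)) (E : tup C sg -> set (tup C sg)).

Definition equivalence_on X E : Prop :=
  [/\ forall a b, E a b -> X a /\ X b,
      forall a, X a -> E a a,
      forall a b, E a b -> E b a
    & forall a b c, E a b -> E b c -> E a c].

(* The class of [a] is the set [E a]. *)
Definition classes X E : set (set (tup C sg)) := E @` X.

Definition bounded_rel (K : Type) X E : Prop := small K (classes X E).

Definition graph E : set (tup C (sum_sort sg sg)) :=
  [set ab | exists a b, E a b /\ ab = pair_tup a b].

Definition invariant {J : Type} {tg : J -> lsort L} (Z : set (tup C tg)) : Prop :=
  forall f, automorphism f -> act f @` Z `<=` Z.

Definition Fsigma_rel E : Prop :=
  invariant (graph E) /\ Fsigma (types_of set0 (graph E)).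

Definition orbital X E : Prop :=
  exists G, [/\ aut_group G,
    forall D f, classes X E D -> G f -> act f @` D = D
    & forall D a b, classes X E D -> D a -> D b -> exists2 f, G f & act f a = b].

Definition restr Z E : tup C sg -> set (tup C sg) :=
  fun a => [set b | [/\ Z a, Z b & E a b]].

Definition refines_type E : Prop :=
  forall a b, E a b -> tp set0 a = tp set0 b.

Definition orbital_on_types X E : Prop :=
  refines_type E /\
  forall p, types_of set0 X p ->
    orbital [set a | tp set0 a = p] (restr [set a | tp set0 a = p] E).

Definition pseudo_closed (K : Type) Y : Prop :=
  exists2 A : set (elt C), small K A & type_definable_over A Y.

Definition rel_saturated E Y : Prop := forall a, Y a -> E a `<=` Y.

Section NormalForms.
Context (R : realType).
Variable Phi : nat -> set (formula_over set0 (sum_sort sg sg)).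

Local Open Scope ereal_scope.

(* Infimum in the extended reals: the minimum if some [Phi n] holds, and
   [+oo] otherwise. *)
Definition nf_dist (a b : tup C sg) : \bar R :=
  ereal_inf [set (n%:R)%:E | n in [set n | solutions (Phi n) (pair_tup a b)]].

Definition normal_form X E : Prop :=
  [/\ solutions (Phi 0%N) = [set pair_tup a a | a in X],
      forall n a b, solutions (Phi n) (pair_tup a b) -> X a /\ X b,
      forall n, solutions (Phi n) `<=` solutions (Phi n.+1),
      forall a b, X a -> X b ->
        (E a b <-> exists n, solutions (Phi n) (pair_tup a b))
    & [/\ forall a b, X a -> X b -> (nf_dist a b = 0 <-> a = b),
          forall a b, X a -> X b -> nf_dist a b = nf_dist b a
        & forall a b c, X a -> X b -> X c ->
            nf_dist a c <= nf_dist a b + nf_dist b c]].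

Definition diameter (D : set (tup C sg)) : \bar R :=
  ereal_sup [set nf_dist ab.1 ab.2 | ab in D `*` D].

End NormalForms.

End Relations.

End Monster.
Arguments types_of {L C I sg} A Z.
Arguments sum_sort {L I} sg {J} tg.
Arguments diameter {L C I sg} R Phi D.
Arguments normal_form {L C I sg} R Phi X E.

Definition borel (T : topologicalType) : set (set T) :=
  <<s [set U : set T | open U] >>.

Definition borel_fun (T U : topologicalType) (f : T -> U) : Prop :=
  forall B, borel B -> borel (f @^-1` B).

Definition polish (R : realType) (P : completePseudoMetricType R) : Prop :=
  hausdorff_space P /\ exists2 D : set P, countable D & dense D.

Definition smooth_rel (R : realType) (T : topologicalType) (Q : T -> T -> Prop)
  : Prop :=
  exists P : completePseudoMetricType R, polish P /\
    exists2 f : T -> P, borel_fun f & forall p q, Q p q <-> f p = f q.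

Section Smooth.
Context {L : language} {C : structure L} {I : Type} {sg : I -> lsort L}.

(* [E^M] on the whole type space; only its trace on [Y_M] is used. *)
Definition type_rel (E : tup C sg -> set (tup C sg)) (M : set (elt C))
    (p q : ctype M sg) : Prop :=
  exists a b, [/\ tp M a = p, tp M b = q & E a b].

(* [Y_M] is the subtype [types_of M Y] of [ctype M sg], with the subspace
   topology. *)
Definition smooth_restr (R : realType) (E : tup C sg -> set (tup C sg))
    (Y : set (tup C sg)) : Prop :=
  exists M : set (elt C), [/\ elementary_submodel M, countable M
    & smooth_rel R (fun p q : types_of M Y => type_rel E (sval p) (sval q))].

End Smooth.

(* Main.v *)
From HB Require Import structures.
From mathcomp Require Import all_boot all_order all_algebra.
From mathcomp Require Import all_classical all_reals all_analysis.
Require Import Defs.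

(** Smoothness is contradicted by topological dynamics and Baire category, with
    ultrafilters on the product of sorts containing [X] in the role of global
    types.

    The class [D] lies in one complete type, on which a group [G] of automorphisms
    preserves every class and acts transitively on each.  It acts on the compact
    space of ultrafilters containing [D]; let [S] be a minimal nonempty closed
    invariant subset, presented by a maximal invariant family of sets with the
    finite intersection property ([maximal_invariant_fip]).  Finitely many
    translates of any nonempty open subset of [S] cover [S]
    ([minimal_flow_minimal]).

    Assume that the relation induced on types over a countable model [M] is
    smooth, witnessed by a Borel map [f].  By saturation ([realize_filter]) the
    type over [M] of an ultrafilter of [S] is realized in [Y], and composing [f]
    with the continuous map sending an ultrafilter to its type over [M] gives a
    [G]-invariant map on [S], along which preimages of Borel sets have the Baire
    property.  By minimality each of them is meager or comeager
    ([invariant_meager_or_comeager]), so the map is constant on a comeager set.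
    As [E] is bounded and invariant, having the same type over [M] implies [E]
    ([eq_tp_model_rel]); hence comeagerly many ultrafilters of [S] are at finite
    distance from one tuple [c0] realizing one of them over [M]
    ([flow_comeager_rel]).

    By the Baire category theorem ([ultra_space_nonmeager]) one of the closed sets
    of ultrafilters at distance at most [n] from [c0] has nonempty interior, and
    covering [S] by translates shows that all of [S] is at distance at most some
    [N] from [c0] ([flow_near_point]).  Since [S] is invariant and [G] is transitive
    on the class of [c0], all of [S] is at distance at most [N] from every point of
    that class ([flow_class_bounded]), which therefore has diameter at most [2 N].
    But [c0] has the same type as the points of [D], so an automorphism maps [D]
    onto the class of [c0], and [D] has finite diameter. *)

Set Implicit Arguments.
Unset Strict Implicit.
Unset Printing Implicit Defensive.
Import Order.TTheory GRing.Theory Num.Theory.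

Local Open Scope classical_set_scope.
Local Open Scope card_scope.

(** * Finite, countable and small sets *)

Lemma countable_setU {T : Type} (A B : set T) :
  countable A -> countable B -> countable (A `|` B).
Proof.
move=> cA cB; apply: (@sub_countable _ _ _ (\bigcup_(b : bool) if b then A else B)).
  by apply: subset_card_le => x [Ax|Bx]; [exists true|exists false].
by apply: bigcup_countable => // -[].
Qed.

Lemma finite_set_ind {T : Type} (P : set T -> Prop) : P set0 ->
  (forall x A, P A -> P (x |` A)) -> forall A, finite_set A -> P A.
Proof.
move=> P0 PU A /finite_setP[n]; elim: n A => [A|n IH A].
  by rewrite II0 card_eq0 => /eqP ->.
move=> /eq_cardSP[x Ax Axn]; rewrite -(setD1K Ax).
by apply: PU; exact: IH.
Qed.

Lemma countable_setT_sum {T1 T2 : Type} :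
  countable [set: T1] -> countable [set: T2] -> countable [set: T1 + T2].
Proof.
move=> c1 c2; apply: (@sub_countable _ _ _ ((inl @` setT) `|` (inr @` setT))).
  by apply: subset_card_le => -[x|x] _; [left|right]; exists x.
by apply: countable_setU; [apply: sub_countable c1|apply: sub_countable c2];
  exact: card_image_le.
Qed.

Section Cardinals.
Context {K : Type}.

(** Absorption [|A| * aleph_0 <= |A|]: by Zorn, [A] is, up to a finite
    remainder, a disjoint union of ranges of injective sequences. *)
Lemma infinite_card_prod_nat {T : Type} (A : set T) : infinite_set A ->
  A `*` [set: nat] #<= A.
Proof.
move=> Ainf.
pose P (S : set (nat -> T)) := (forall f n, S f -> A (f n)) /\
  (forall f g n m, S f -> S g -> f n = g m -> f = g /\ n = m).
have [F|S [[SA SI] Smax]] := @Zorn_bigcup (nat -> T) P.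
  move=> FP Ftot; split=> [f n [S FS Sf]|f g n m [S FS Sf] [S' FS' S'g]].
    exact: (FP S FS).1.
  have [le|le] := Ftot _ _ FS FS'.
    by apply: (FP _ FS').2 => //; exact: le.
  by apply: (FP _ FS).2 => //; exact: le.
pose A0 := A `\` [set f n | f in S & n in [set: nat]].
have A0fin : finite_set A0.
  apply: contrapT => /infiniteP/pfcard_geP[|].
    by move=> nat0; have : [set: nat] 0%N by []; rewrite nat0.
  move=> [e].
  have /choice[s sP] : forall n, exists x, A0 x /\ e x = n.
    by move=> n; have [x A0x <-] := @surj _ _ _ _ e n I; exists x.
  have sinj n m : s n = s m -> n = m by move=> nm; rewrite -(sP n).2 nm (sP m).2.
  apply: (Smax (S `|` [set s])).
    split=> [f Sf|]; first by left.
    move=> /(_ s (or_intror erefl)) Ss; have [_] := (sP 0%N).1; apply.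
    by exists s => //; exists 0%N.
  split=> [f n [/SA//|->]|]; first by have [[]] := sP n.
  move=> f g n m [Sf|->] [Sg|->].
  - exact: SI.
  - by move=> E; have [[_ []]] := sP m; exists f => //; exists n.
  - by move=> E; have [[_ []]] := sP n; exists g => //; exists m.
  - by move=> /sinj ->.
have [s0 Ss0] : S !=set0.
  apply: contra_notP Ainf => S0; apply: sub_finite_set A0fin => x Ax.
  by split=> // -[f Sf]; case: S0; exists f.
have [e eP] : exists e : nat -> T, A0 `<=` range e.
  have /pfcard_geP[->|[e]] := finite_set_countable A0fin.
    by exists (s0) => x [].
  by exists e => x A0x; have [n _ <-] := @surj _ _ _ _ e x A0x; exists n.
(* The pairs in [A `*` setT] are images of pairs (sequence in [S], index): the
   index codes the second component and the position of the first one, either in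
   the sequence or in an enumeration [e] of the remainder. *)
pose D n : bool * nat * nat := odflt (true, 0, 0)%N (unpickle n).
pose F (u : (nat -> T) * nat) :=
  let: (b, k, l) := D u.2 in (if b then u.1 k else e k, l).
apply: (@card_le_trans _ _ _ (S `*` [set: nat])).
  apply: card_le_trans (card_image_le F _); apply: subset_card_le => -[x l] /= [Ax _].
  have [[f Sf [k _ fk]]|nx] := pselect ([set f n | f in S & n in [set: nat]] x).
    exists (f, pickle (true, k, l)) => //=.
    by rewrite /F /D pickleK /= fk.
  have [k _ ek] : range e x by apply: eP.
  exists (s0, pickle (false, k, l)) => //=.
  by rewrite /F /D pickleK /= ek.
pose G (u : (nat -> T) * nat) := u.1 u.2.
have : (G @` (S `*` [set: nat])) #= (S `*` [set: nat]).
  apply: inj_card_eq => -[f n] [g m] /set_mem[/= Sf _] /set_mem[/= Sg _].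
  by move=> /SI [] // -> ->.
rewrite card_eq_le => /andP[_ le].
apply: card_le_trans le _; apply: subset_card_le => _ [[f n] [/= Sf _] <-].
exact: SA.
Qed.

Lemma small_le {T U : Type} (A : set T) (B : set U) :
  A #<= B -> small K B -> small K A.
Proof.
move=> AB [BK nKB]; split; first exact: card_le_trans BK.
by move=> KA; apply: nKB; apply: card_le_trans AB.
Qed.

Lemma small_subset {T : Type} (A B : set T) : A `<=` B -> small K B -> small K A.
Proof. by move=> /subset_card_le; exact: small_le. Qed.

Hypothesis K_large : card_lt [set: set nat] [set: K].

Lemma small_countable {T : Type} (A : set T) : countable A -> small K A.
Proof.
move=> cA; apply: (@small_le _ _ _ [set: set nat]) => //.
apply: card_le_trans cA _.
have : ((fun n : nat => [set n]) @` setT) #= [set: nat].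
  apply: inj_card_eq => n m _ _ nm.
  by have : [set n] m by rewrite nm.
rewrite card_eq_le => /andP[_ le].
by apply: card_le_trans le _; apply: subset_card_le.
Qed.

Lemma small_bigcup_countable {T U : Type} (W : set T) (F : T -> set U) :
  small K W -> (forall w, countable (F w)) -> small K (\bigcup_(w in W) F w).
Proof.
move=> sW cF; have [finW|infW] := pselect (finite_set W).
  apply: small_countable; apply: bigcup_countable => // ; exact: finite_set_countable.
apply: small_le sW; apply: card_le_trans (infinite_card_prod_nat infW).
have [[u0 _]|/set0P/negP/negPn/eqP->] :=
  pselect ((\bigcup_(w in W) F w) !=set0); last exact: card_ge0.
have /choice[e eP] : forall w, exists e : nat -> U, F w `<=` range e.
  move=> w; have /pfcard_geP[->|[e]] := cF w; first by exists (fun=> u0) => x [].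
  by exists e => x Fx; have [n _ <-] := @surj _ _ _ _ e x Fx; exists n.
apply: card_le_trans (card_image_le (fun u => e u.1 u.2) _).
apply: subset_card_le => x [w Ww /eP[n _ <-]].
by exists (w, n).
Qed.

Lemma small_setU {T : Type} (A B : set T) :
  small K A -> countable B -> small K (A `|` B).
Proof.
move=> sA cB; have [[a Aa]|/set0P/negP/negPn/eqP->] := pselect (A !=set0); last first.
  by rewrite set0U; exact: small_countable.
suff: small K (\bigcup_(x in A) ([set x] `|` B)).
  by apply: small_subset => x [Ax|Bx]; [exists x => //; left|exists a => //; right].
apply: small_bigcup_countable => // x; exact: countable_setU.
Qed.

End Cardinals.

(** * Baire category *)

Section BaireCategory.
Context {T : topologicalType}.
Implicit Types A O : set T.

(** Every nonempty open set has a nonempty open subset that misses [A]. *)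
Definition nowhere_dense A := forall O, open O -> O !=set0 ->
  exists O', [/\ open O', O' !=set0, O' `<=` O & O' `&` A = set0].

(** A set covered by countably many nowhere dense sets. *)
Definition meager A := exists NN : set (set T),
  [/\ countable NN, NN `<=` nowhere_dense & A `<=` \bigcup_(N in NN) N].

(** Equality to an open set modulo a meager set. *)
Definition baire_property A := exists2 O, open O & meager (A `+` O).

Lemma meager_subset A A' : A `<=` A' -> meager A' -> meager A.
Proof. by move=> AA' [NN [cN NN_nd sub]]; exists NN; split=> // x /AA'/sub. Qed.

Lemma meager_bigcup {I : Type} (D : set I) (F : I -> set T) :
  countable D -> (forall i, D i -> meager (F i)) -> meager (\bigcup_(i in D) F i).
Proof.
move=> cD mF.
have /choice[NN NNP] : forall i, exists NN : set (set T), D i ->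
    [/\ countable NN, NN `<=` nowhere_dense & F i `<=` \bigcup_(N in NN) N].
  move=> i; have [Di|nDi] := pselect (D i); last by exists set0.
  by have [NN NNP] := mF i Di; exists NN.
exists (\bigcup_(i in D) NN i); split.
- by apply: bigcup_countable => // i /NNP[].
- by move=> N [i /NNP[_ + _]]; apply.
- move=> x [i Di Fx]; have [_ _ /(_ x Fx) [N NN_N Nx]] := NNP i Di.
  by exists N => //; exists i.
Qed.

Lemma meagerU A A' : meager A -> meager A' -> meager (A `|` A').
Proof.
move=> mA mA'; apply: (@meager_subset _ (\bigcup_(b : bool) if b then A else A')).
  by move=> x [Ax|A'x]; [exists true|exists false].
by apply: meager_bigcup => // -[].
Qed.

Lemma nowhere_dense_meager A : nowhere_dense A -> meager A.
Proof.
move=> ndA; exists [set A]; split=> //; first by move=> _ ->.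
by move=> x Ax; exists A.
Qed.

Lemma closed_interior0_nowhere_dense A : closed A -> A° = set0 -> nowhere_dense A.
Proof.
move=> cA iA O oO [x Ox]; exists (O `&` ~` A); split.
- by apply: openI => //; exact: closed_openC.
- apply: contrapT => /set0P/negP/negPn/eqP OA; suff: A° x by rewrite iA.
  apply: (filterS _ (open_nbhs_nbhs (conj oO Ox))) => y Oy.
  by apply: contrapT => nAy; have : set0 y by rewrite -OA.
- exact: subIsetl.
- by rewrite -setIA setICl setI0.
Qed.

Lemma open_baire_property A : open A -> baire_property A.
Proof.
move=> oA; exists A => //; apply: meager_subset (_ : meager set0).
  by move=> x [[]|[]].
by exists set0; split=> // x [].
Qed.

Lemma baire_propertyC A : baire_property A -> baire_property (~` A).
Proof.
move=> [ O oO mAO]; exists (~` O)°; first exact: open_interior.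
pose B := ~` O `\` (~` O)°.
have ndB : nowhere_dense B.
  apply: closed_interior0_nowhere_dense.
    apply: closedI; first exact: open_closedC.
    by apply: open_closedC; exact: open_interior.
  rewrite -subset0 => x Bx; have [nOx nix] := interior_subset Bx.
  by apply: nix; apply: filterS Bx => y [].
apply: meager_subset (meagerU mAO (nowhere_dense_meager ndB)) => x.
case=> [[nAx nix]|[ix Ax]]; have [Ox|nOx] := pselect (O x).
- by left; right.
- by right.
- by have := interior_subset ix.
- by left; left; split=> //; exact: contrapT.
Qed.

Lemma baire_property_bigcup (F : nat -> set T) :
  (forall n, baire_property (F n)) -> baire_property (\bigcup_n F n).
Proof.
move=> /(_ _)/cid2-/all_sig2[ O oO mFO].
exists (\bigcup_n O n); first exact: bigcup_open.
apply: (@meager_subset _ (\bigcup_n (F n `+` O n))).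
  move=> x [[[n _ Fx] nO]|[[n _ Ox] nF]]; exists n => //.
    by left; split=> // Ox; apply: nO; exists n.
  by right; split=> // Fx; apply: nF; exists n.
exact: meager_bigcup.
Qed.

Lemma borel_preimage_baire_property {U : topologicalType} (r : T -> U) (B : set U) :
  continuous r -> borel B -> baire_property (r @^-1` B).
Proof.
move=> /continuousP rc; move: B.
pose Bad : set (set U) := [set B | baire_property (r @^-1` B)].
suff : borel (T:=U) `<=` Bad by [].
apply: smallest_sub; last first.
  by move=> B oB; apply: open_baire_property; exact: rc.
split.
- by rewrite /Bad /= preimage_set0; apply: open_baire_property; exact: open0.
- by move=> B bB; rewrite /Bad /= setTD preimage_setC; exact: baire_propertyC.
- by move=> F bF; rewrite /Bad /= preimage_bigcup; exact: baire_property_bigcup.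
Qed.

(** A set of self-homeomorphisms such that finitely many preimages of any nonempty
    open set cover the space; for a group acting on a compact space this says that
    the action is minimal. *)
Definition minimal_action (H : set (T -> T)) :=
  (forall h, H h -> exists h' : T -> T,
     [/\ continuous h, continuous h', cancel h h' & cancel h' h]) /\
  (forall O, open O -> O !=set0 -> exists F : set (T -> T),
     [/\ finite_set F, F `<=` H & forall x, exists2 h, F h & O (h x)]).

Lemma meager_preimage (h h' : T -> T) A : continuous h -> continuous h' ->
  cancel h h' -> cancel h' h -> meager A -> meager (h @^-1` A).
Proof.
move=> /continuousP hc /continuousP h'c hK h'K [NN [cN NN_nd sub]].
exists [set h @^-1` N | N in NN]; split.
- by apply: sub_countable cN; exact: card_image_le.
- move=> _ [N /NN_nd ndN <-] O oO [x Ox].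
  have [||O' [oO' [y O'y] O'O O'N]] := ndN (h' @^-1` O); first exact: h'c.
    by exists (h x); rewrite /= hK.
  exists (h @^-1` O'); split; first exact: hc.
  + by exists (h' y); rewrite /= h'K.
  + by move=> z /O'O; rewrite /= hK.
  + by rewrite -preimage_setI O'N preimage_set0.
- move=> x /sub[N NN_N Nx]; exists (h @^-1` N) => //; by exists N.
Qed.

(** Topological zero-one law: an invariant set with the Baire property that is
    not meager is comeager in some nonempty open set, hence in each of its
    translates, hence in the whole space. *)
Lemma invariant_meager_or_comeager (H : set (T -> T)) A : minimal_action H ->
  (forall h, H h -> h @^-1` A = A) -> baire_property A ->
  meager A \/ meager (~` A).
Proof.
move=> [Hinv Hcov] HA [ O oO mAO].
have [/(Hcov O oO)[F [finF FH Fcov]]|/set0P/negP/negPn/eqP O0] :=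
  pselect (O !=set0); last first.
  left; apply: meager_subset mAO => x Ax; left; split=> //.
  by rewrite O0.
right; apply: (@meager_subset _ (\bigcup_(h in F) h @^-1` (A `+` O))).
  move=> x nAx; have [h Fh Ohx] := Fcov x; exists h => //; right; split=> //.
  by move=> Ahx; apply: nAx; rewrite -(HA h (FH _ Fh)).
apply: meager_bigcup; first exact: finite_set_countable.
move=> h /FH Hh; have [h' [hc h'c hK h'K]] := Hinv h Hh.
exact: meager_preimage hc h'c hK h'K mAO.
Qed.

(** A map to a Polish space for which every preimage of an open set is meager
    or comeager is constant on a comeager set. *)
Lemma comeager_constant {R : realType} {P : completePseudoMetricType R}
    (g : T -> P) : polish P ->
  (forall B : set P, open B -> meager (g @^-1` B) \/ meager (~` (g @^-1` B))) ->
  exists G : set T, meager (~` G) /\ forall x y, G x -> G y -> g x = g y.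
Proof.
move=> [hP [D cD dD]] zo.
(* [N u] is whichever of the preimage of the [u]-th basic open set and its complement
   is meager; off their union, [g] meets the same basic open sets. *)
pose V (u : P * nat) : set P := (ball u.1 (u.2.+1%:R^-1))°.
pose N u := if pselect (meager (g @^-1` V u)) then g @^-1` V u else ~` (g @^-1` V u).
have mN u : meager (N u).
  rewrite /N; case: pselect => // nm.
  by have [] := zo (V u) (open_interior _).
exists (~` \bigcup_(u in D `*` [set: nat]) N u); split.
  rewrite setCK; apply: meager_bigcup => //; exact: countableX.
move=> x y Gx Gy; apply: hP => A B nA nB.
move: nA => /nbhs_ballP[e /= e0 eA].
have e20 : (0 < e / 2)%R by apply: divr_gt0.
have [n ne] : exists n : nat, (n.+1%:R^-1 < e / 2 :> R)%R.
  have [n _ /(_ n (leqnn n)) nP] := near_infty_natSinv_lt (PosNum e20).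
  by exists n.
have n0 : (0 < n.+1%:R^-1 :> R)%R by rewrite invr_gt0.
have [d [Dd dgx]] : exists d, D d /\ V (d, n) (g x).
  have [d [/= dn Dd]] : ((ball (g x) (n.+1%:R^-1 / 2)%R)° `&` D) !=set0.
    apply: dD; last exact: open_interior.
    by exists (g x); apply: nbhsx_ballx; apply: divr_gt0.
  exists d; split=> //=; rewrite /V /=.
  apply/nbhs_ballP; exists (n.+1%:R^-1 / 2)%R => /=; first exact: divr_gt0.
  by move=> z; apply: ball_split; apply: ball_sym; exact: interior_subset dn.
have Du : (D `*` [set: nat]) (d, n) by [].
have Vy : V (d, n) (g y).
  have : ~ N (d, n) x by move=> Nx; apply: Gx; exists (d, n).
  have : ~ N (d, n) y by move=> Ny; apply: Gy; exists (d, n).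
  by rewrite /N; case: pselect => _ //= nn _; exact: contrapT.
exists (g y); split; last exact: nbhs_singleton.
apply: eA; apply: (@le_ball _ _ _ (n.+1%:R^-1 + n.+1%:R^-1)%R).
  by rewrite (splitr e); apply: lerD; exact: ltW.
apply: (@ball_triangle _ _ d); last exact: interior_subset Vy.
by apply: ball_sym; exact: interior_subset dgx.
Qed.

End BaireCategory.

(** * Substitution and definable sets *)

Section Substitution.
Context {L : language}.

(** Simultaneous substitution; it is used with terms that are variables, possibly
    standing for parameters. *)
Fixpoint subst_term (I : Type) (sg : I -> lsort L) (J : Type) (tg : J -> lsort L)
    (sigma : forall i, term tg (sg i)) (s : lsort L) (t : term sg s) : term tg s :=
  match t with
  | Var i => sigma i
  | App f args => App (fun k => subst_term sigma (args k))
  end.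

(** The substitution under a quantifier, fixing the bound variable [None]. *)
Definition lift_subst (I : Type) (sg : I -> lsort L) (J : Type) (tg : J -> lsort L)
    (sigma : forall i, term tg (sg i)) (s : lsort L) :
    forall o, term (ext_sort tg s) (ext_sort sg s o) :=
  fun o => match o with
  | Some i => subst_term (fun j => Var (ext_sort tg s) (Some j)) (sigma i)
  | None => Var (ext_sort tg s) None
  end.

Fixpoint subst (I : Type) (sg : I -> lsort L) (phi : formula sg) :
    forall (J : Type) (tg : J -> lsort L), (forall i, term tg (sg i)) -> formula tg :=
  match phi with
  | Fals => fun J tg sigma => Fals
  | Eq s t u => fun J tg sigma => Eq (subst_term sigma t) (subst_term sigma u)
  | Rel r args => fun J tg sigma => Rel (fun k => subst_term sigma (args k))
  | Imp phi psi => fun J tg sigma => Imp (subst phi sigma) (subst psi sigma)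
  | All s phi => fun J tg sigma => All (subst phi (lift_subst sigma s))
  end.

Context {N : structure L}.

Lemma eval_subst (I : Type) (sg : I -> lsort L) (J : Type) (tg : J -> lsort L)
    (sigma : forall i, term tg (sg i)) (a : tup N tg) (s : lsort L) (t : term sg s) :
  eval a (subst_term sigma t) = eval (fun i => eval a (sigma i) : N (sg i)) t.
Proof.
elim: t => //= f args IH; congr (fun_int N f _).
by apply: functional_extensionality_dep => k; exact: IH.
Qed.

Lemma sat_subst (I : Type) (sg : I -> lsort L) (phi : formula sg) :
  forall (J : Type) (tg : J -> lsort L) (sigma : forall i, term tg (sg i))
    (a : tup N tg),
  sat a (subst phi sigma) <-> sat (fun i => eval a (sigma i) : N (sg i)) phi.
Proof.
elim: phi => {I sg} [I sg|I sg s t u|I sg r args|I sg phi IHphi psi IHpsi|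
  I sg s phi IH]
  J tg sigma a //=.
- by rewrite !eval_subst.
- rewrite (_ : (fun k => eval a (subst_term sigma (args k))) =
    (fun k => eval (fun i => eval a (sigma i)) (args k))) //.
  by apply: functional_extensionality_dep => k; exact: eval_subst.
- by split=> H /IHphi/H/IHpsi.
- have E x : (fun o => eval (ext_tup a x) (lift_subst sigma s o)) =
      ext_tup (fun i => eval a (sigma i) : N (sg i)) x.
    apply: functional_extensionality_dep => -[i|//] /=.
    by rewrite eval_subst.
  by split=> H x; have := H x; rewrite IH E.
Qed.

(** The truth value of [a] in [Z] depends on the coordinates in [F] only. *)
Definition depends_on (I : Type) (sg : I -> lsort L) (F : set I)
    (Z : set (tup N sg)) : Prop :=
  forall a b : tup N sg, (forall i, F i -> a i = b i) -> Z a -> Z b.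

Lemma eval_finite_support (I : Type) (sg : I -> lsort L) (s : lsort L) (t : term sg s) :
  exists2 F : set I, finite_set F & forall a b : tup N sg,
    (forall i, F i -> a i = b i) -> eval a t = eval b t.
Proof.
elim: t => [i|f args IH]; first by exists [set i] => // a b; exact.
have /choice[F FP] : forall k, exists F : set I, finite_set F /\
    forall a b : tup N sg, (forall i, F i -> a i = b i) ->
      eval a (args k) = eval b (args k).
  by move=> k; have [F finF FP] := IH k; exists F.
exists (\bigcup_k F k).
  by apply: bigcup_finite => // k _; exact: (FP k).1.
move=> a b ab /=; congr (fun_int N f _); apply: functional_extensionality_dep => k.
by apply: (FP k).2 => i Fi; apply: ab; exists k.
Qed.

Lemma sat_finite_support (I : Type) (sg : I -> lsort L) (phi : formula sg) :
  exists2 F : set I, finite_set F & depends_on F [set a : tup N sg | sat a phi].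
Proof.
elim: phi => {I sg} [I sg|I sg s t u|I sg r args|I sg phi IHphi psi IHpsi|
  I sg s phi IH].
- by exists set0.
- have [F finF FP] := eval_finite_support t.
  have [F' finF' F'P] := eval_finite_support u.
  exists (F `|` F'); first by rewrite finite_setU.
  move=> a b ab /= E; rewrite -(FP a) ?E; last by move=> i Fi; apply: ab; left.
  by apply: F'P => i Fi; apply: ab; right.
- have /choice[F FP] : forall k, exists F : set I, finite_set F /\
      forall a b : tup N sg, (forall i, F i -> a i = b i) ->
        eval a (args k) = eval b (args k).
    by move=> k; have [F finF FP] := eval_finite_support (args k); exists F.
  exists (\bigcup_k F k).
    by apply: bigcup_finite => // k _; exact: (FP k).1.
  move=> a b ab /=.
  suff -> : (fun k => eval a (args k)) = (fun k => eval b (args k)) by [].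
  apply: functional_extensionality_dep => k.
  by apply: (FP k).2 => i Fi; apply: ab; exists k.
- have [F finF FP] := IHphi; have [F' finF' F'P] := IHpsi.
  exists (F `|` F'); first by rewrite finite_setU.
  move=> a b ab /= H bphi.
  apply: (F'P a) => [i Fi|]; first by apply: ab; right.
  by apply: H; apply: (FP b) => // i Fi; apply/esym/ab; left.
- have [F finF FP] := IH; exists (Some @^-1` F).
    by apply: finite_preimage finF => x y _ _ [].
  move=> a b ab /= H x; apply: (FP (ext_tup a x)) (H x) => -[i|//] Fi /=.
  exact: ab.
Qed.

End Substitution.

Section Definable.
Context {L : language} {C : structure L}.
Implicit Types A B : set (elt C).

(** The set of coordinates of a tuple. *)
Definition coords {I : Type} {sg : I -> lsort L} (a : tup C sg) : set (elt C) :=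
  [set existT _ (sg i) (a i) | i in [set: I]].

Lemma countable_coords {I : Type} {sg : I -> lsort L} (a : tup C sg) :
  countable [set: I] -> countable (coords a).
Proof. by apply: sub_countable; exact: card_image_le. Qed.

(** The [A]-definable subsets of a product of sorts. The later arguments are
    carried out with these sets rather than with formulas. *)
Definition definable A {I : Type} {sg : I -> lsort L} (Z : set (tup C sg)) : Prop :=
  exists phi : formula_over A sg, Z = [set a | holds a phi].

(** A map between products of sorts all of whose coordinates are given by terms
    with parameters in [B]. *)
Definition term_map B {J : Type} {tg : J -> lsort L} {I : Type} {sg : I -> lsort L}
    (h : tup C tg -> tup C sg) : Prop :=
  forall i, exists t : term (sum_sort tg (@par_sort _ _ B)) (sg i),
    forall a, h a i = eval (pair_tup a (@par_tup _ _ B)) t.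

Lemma term_coord B {J : Type} {tg : J -> lsort L} (j : J) :
  exists t : term (sum_sort tg (@par_sort _ _ B)) (tg j),
    forall a, a j = eval (pair_tup a (@par_tup _ _ B)) t.
Proof. by exists (Var (sum_sort tg (@par_sort _ _ B)) (inl j)). Qed.

Lemma term_param B {J : Type} {tg : J -> lsort L} (s : lsort L) (x : C s) :
  B (existT _ s x) ->
  exists t : term (sum_sort tg (@par_sort _ _ B)) s,
    forall a, x = eval (pair_tup a (@par_tup _ _ B)) t.
Proof.
move=> Bx; pose c : B := exist _ (existT _ s x) (mem_set Bx).
by exists (Var (sum_sort tg (@par_sort _ _ B)) (inr c)).
Qed.

(** Definable sets pull back along maps given by terms; renaming variables and
    fixing some of them to parameters are special cases. *)
Lemma definable_preimage A B {J : Type} {tg : J -> lsort L} {I : Type}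
    {sg : I -> lsort L} (h : tup C tg -> tup C sg) (Z : set (tup C sg)) :
  A `<=` B -> term_map B h -> definable A Z -> definable B (h @^-1` Z).
Proof.
move=> AB hB [phi ->].
have [t tP] : exists t : forall i, term (sum_sort tg (@par_sort _ _ B)) (sg i),
    forall i a, h a i = eval (pair_tup a (@par_tup _ _ B)) (t i).
  exists (fun i => projT1 (cid (hB i))) => i; exact: projT2 (cid (hB i)).
have [u uP] : exists u : forall c : A,
      term (sum_sort tg (@par_sort _ _ B)) (par_sort c),
    forall c a, par_tup c = eval (pair_tup a (@par_tup _ _ B)) (u c).
  have H (c : A) : exists u : term (sum_sort tg (@par_sort _ _ B)) (par_sort c),
      forall a, par_tup c = eval (pair_tup a (@par_tup _ _ B)) u.
    apply: term_param; apply: AB; case: c => -[s x] Ac /=; exact: set_mem.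
  exists (fun c => projT1 (cid (H c))) => c; exact: projT2 (cid (H c)).
pose sigma (x : I + A) : term (sum_sort tg (@par_sort _ _ B))
    (sum_sort sg (@par_sort _ _ A) x) :=
  match x with inl i => t i | inr c => u c end.
exists (subst phi sigma); apply/funext => a; apply/propext.
rewrite /= /holds sat_subst.
rewrite (_ : (fun x => _) = pair_tup (h a) (@par_tup _ _ A)) //.
by apply: functional_extensionality_dep => -[i|c] /=; rewrite -?tP -?uP.
Qed.

Lemma definableS A B {I : Type} {sg : I -> lsort L} (Z : set (tup C sg)) :
  A `<=` B -> definable A Z -> definable B Z.
Proof.
by move=> AB; apply: (@definable_preimage _ _ _ _ _ _ id) => // i; exact: term_coord.
Qed.

Lemma definable_impl A {I : Type} {sg : I -> lsort L} (Z Z' : set (tup C sg)) :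
  definable A Z -> definable A Z' -> definable A [set a | Z a -> Z' a].
Proof. by move=> [phi ->] [psi ->]; exists (Imp phi psi). Qed.

Lemma definable0 A {I : Type} {sg : I -> lsort L} : definable A (@set0 (tup C sg)).
Proof. by exists Fals. Qed.

Lemma definableC A {I : Type} {sg : I -> lsort L} (Z : set (tup C sg)) :
  definable A Z -> definable A (~` Z).
Proof. by move=> /definable_impl H; have := H _ (definable0 A). Qed.

Lemma definableT A {I : Type} {sg : I -> lsort L} : definable A [set: tup C sg].
Proof. by rewrite -setC0; apply: definableC; exact: definable0. Qed.

Lemma definableI A {I : Type} {sg : I -> lsort L} (Z Z' : set (tup C sg)) :
  definable A Z -> definable A Z' -> definable A (Z `&` Z').
Proof.
move=> dZ dZ'; rewrite (_ : Z `&` Z' = ~` [set a | Z a -> (~` Z') a]).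
  by apply/definableC/definable_impl => //; exact: definableC.
apply/seteqP; split=> a /=; first by move=> [Za Z'a] /(_ Za).
by move=> H; split; apply: contrapT => nZ; apply: H.
Qed.

(** Replacement of the [i]-th coordinate of [a] by [x]. *)
Definition upd {I : Type} {sg : I -> lsort L} (a : tup C sg) (i : I) (x : C (sg i)) :
    tup C sg :=
  fun j => match pselect (i = j) with
  | left e => eq_rect i (fun j => C (sg j)) x j e
  | right _ => a j
  end.

Lemma upd_same {I : Type} {sg : I -> lsort L} (a : tup C sg) (i : I) (x : C (sg i)) :
  upd a x i = x.
Proof.
rewrite /upd; case: pselect => // e.
by rewrite (Prop_irrelevance e erefl).
Qed.

Lemma upd_other {I : Type} {sg : I -> lsort L} (a : tup C sg) (i j : I)
  (x : C (sg i)) : i <> j -> upd a x j = a j.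
Proof. by rewrite /upd; case: pselect. Qed.

Lemma upd_id {I : Type} {sg : I -> lsort L} (a : tup C sg) (i : I) : upd a (a i) = a.
Proof.
apply: functional_extensionality_dep => j; have [<-|ij] := pselect (i = j).
  exact: upd_same.
exact: upd_other.
Qed.

(** Projection along the variable added by a quantifier. *)
Lemma definable_ext_exists A {I : Type} {sg : I -> lsort L} (s : lsort L)
    (Z : set (tup C (ext_sort sg s))) :
  definable A Z -> definable A [set a | exists x, Z (ext_tup a x)].
Proof.
move=> [phi ->].
pose psi : formula (ext_sort (sum_sort sg (@par_sort _ _ A)) s) :=
  subst phi (fun x => match x return term (ext_sort (sum_sort sg (@par_sort _ _ A)) s)
      (sum_sort (ext_sort sg s) (@par_sort _ _ A) x) with
    | inl (Some i) => Var (ext_sort (sum_sort sg (@par_sort _ _ A)) s) (Some (inl i))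
    | inl None => Var (ext_sort (sum_sort sg (@par_sort _ _ A)) s) None
    | inr c => Var (ext_sort (sum_sort sg (@par_sort _ _ A)) s) (Some (inr c))
    end).
have psiP a x : sat (ext_tup (pair_tup a (@par_tup _ _ A)) x) psi <->
    holds (ext_tup a x) phi.
  rewrite /holds sat_subst
    (_ : (fun x => _) = pair_tup (ext_tup a x) (@par_tup _ _ A)) //.
  by apply: functional_extensionality_dep => -[[i|]|c].
exists (Neg (All (Neg psi))); apply/funext => a; apply/propext; split=> /=.
  by move=> [x Zx] /(_ x); apply; apply/psiP.
move=> H; apply: contrapT => nx; apply: H => x /psiP Zx; apply: nx.
by exists x.
Qed.

(** Projection along one of the coordinates. *)
Lemma definable_exists A {I : Type} {sg : I -> lsort L} (i : I) (Z : set (tup C sg)) :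
  definable A Z -> definable A [set a | exists x : C (sg i), Z (upd a x)].
Proof.
move=> dZ.
pose h (b : tup C (ext_sort sg (sg i))) : tup C sg :=
  upd (fun j => b (Some j) : C (sg j)) (b None : C (sg i)).
have /definable_ext_exists : definable A (h @^-1` Z).
  apply: definable_preimage dZ => // j; rewrite /h /upd.
  case: pselect => [e|_]; last first.
    exact: (@term_coord A (option I) (ext_sort sg (sg i)) (Some j)).
  by case: _ / e; exact: (@term_coord A (option I) (ext_sort sg (sg i)) None).
by [].
Qed.

(** Fixing all coordinates of a tuple except the [i]-th. *)
Lemma definable_section A B {I : Type} {sg : I -> lsort L} (c : tup C sg) (i : I)
    (Z : set (tup C sg)) : A `<=` B -> coords c `<=` B -> definable A Z ->
  definable B [set y : tup C (fun _ : unit => sg i) | Z (upd c (y tt))].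
Proof.
move=> AB cB; apply: (@definable_preimage _ _ _ _ _ _
  (fun y : tup C (fun _ : unit => sg i) => upd c (y tt))) => // j; rewrite /upd.
case: pselect => [e|_].
  by case: _ / e; exact: (@term_coord B unit (fun=> sg i) tt).
by apply: term_param; apply: cB; exists j.
Qed.

Lemma definable_finite_support A {I : Type} {sg : I -> lsort L} (Z : set (tup C sg)) :
  definable A Z -> exists2 F : set I, finite_set F & depends_on F Z.
Proof.
move=> [phi ->]; have [F finF FP] := @sat_finite_support _ C _ _ phi.
exists (inl @^-1` F); first by apply: finite_preimage finF => x y _ _ [].
by move=> a b ab; apply: FP => -[i|c] //= /ab.
Qed.

(** Fixing one half of a pair of tuples. *)
Lemma definable_pair_left B {I : Type} {sg : I -> lsort L} {J : Type}
    {tg : J -> lsort L} (a : tup C sg) (Z : set (tup C (sum_sort sg tg))) :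
  coords a `<=` B -> definable set0 Z ->
  definable B [set x : tup C tg | Z (pair_tup a x)].
Proof.
move=> aB; apply: (@definable_preimage _ _ _ _ _ _ (pair_tup a)) => //.
by move=> [i|j] /=; [apply: term_param; apply: aB; exists i|exact: term_coord].
Qed.

Lemma definable_pair_right B {I : Type} {sg : I -> lsort L} {J : Type}
    {tg : J -> lsort L} (b : tup C tg) (Z : set (tup C (sum_sort sg tg))) :
  coords b `<=` B -> definable set0 Z ->
  definable B [set x : tup C sg | Z (pair_tup x b)].
Proof.
move=> bB; apply: (@definable_preimage _ _ _ _ _ _ (fun x => pair_tup x b)) => //.
by move=> [i|j] /=; [exact: term_coord|apply: term_param; apply: bB; exists j].
Qed.

Lemma ctype_inj A {I : Type} {sg : I -> lsort L} (p q : ctype A sg) :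
  ctype_set p = ctype_set q -> p = q.
Proof.
case: p q => P pP [Q pQ] /= E; move: pP pQ; rewrite E => pP pQ.
by congr CType; exact: Prop_irrelevance.
Qed.

Lemma eq_tpP A {I : Type} {sg : I -> lsort L} (a b : tup C sg) :
  tp A a = tp A b <-> forall Z, definable A Z -> Z a -> Z b.
Proof.
split=> [ab _ [phi ->] /= Ha|H].
  have : ctype_set (tp A a) phi by [].
  by rewrite ab.
have E : ctype_set (tp A a) = ctype_set (tp A b).
  apply/funext => phi; apply/propext; split=> /=.
    by apply: (H [set x | holds x phi]); exists phi.
  apply: contraPP => nHa; apply: (H [set x | ~ holds x phi]) => //.
  by apply: definableC; exists phi.
exact: ctype_inj.
Qed.

End Definable.

(** The topology of the space of types, generated by the sets of types containing
    a given formula, has the finite intersections of these as a base. *)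
Lemma ctype_open_nbhs {L : language} {C : structure L} {A : set (elt C)} {I : Type}
    {sg : I -> lsort L} (O : set (ctype A sg)) (p : ctype A sg) : open O -> O p ->
  exists F : set (formula_over A sg), [/\ finite_set F, F `<=` ctype_set p &
    forall q, F `<=` ctype_set q -> O q].
Proof.
move=> [D' D'f <-] [B D'B Bp]; have [F FD FB] := D'f B D'B.
have [F' [finF' F'D F'B]] : exists F' : set (set (ctype A sg)), [/\ finite_set F',
    forall W, F' W -> exists phi, W = [set p : ctype A sg | ctype_set p phi] &
    \bigcap_(W in F') W = B].
  eexists; split; [exact: (finite_fset F)| |exact: FB].
  by move=> W FW; have := FD W FW; rewrite inE.
have [G [finG Gp GB]] : exists G : set (formula_over A sg), [/\ finite_set G,
    G `<=` ctype_set p & forall q, G `<=` ctype_set q -> forall W, F' W -> W q].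
  have F'p W : F' W -> W p by move: Bp; rewrite /= -F'B; exact.
  move: F'D F'p; rewrite {F'B}.
  move: F' finF'; apply: finite_set_ind => [_ _|W F1 IH Fphi Fp].
    by exists set0; split=> // x [].
  have [|x Fx|G [finG Gp GF]] := IH; [by move=> x Fx; apply: Fphi; right| |].
    by apply: Fp; right.
  have [phi Wphi] := Fphi W (or_introl erefl).
  exists (phi |` G); split; first by rewrite finite_setU; split=> //; exact: finite_set1.
    move=> x [->|/Gp//]; have := Fp W (or_introl erefl); by rewrite Wphi.
  move=> q qG x [->|Fx]; first by rewrite Wphi /=; apply: qG; left.
  by apply: (GF q) => // y Gy; apply: qG; right.
exists G; split=> // q /GB Fq; exists B => //; rewrite /= -F'B => W; exact: Fq.
Qed.

(** * Realizing filters and coheirs *)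

Section Realization.
Context {L : language} {C : structure L} {K : Type}.
Hypothesis K_large : card_lt [set: set nat] [set: K].
Hypothesis C_saturated : saturated C K.

Lemma tup_inhabited {I : Type} (sg : I -> lsort L) (N : structure L) :
  inhabited (tup N sg).
Proof.
have H i : exists x : N (sg i), True.
  by have [x] := carrier_inhabited N (sg i); exists x.
by constructor; exact: (fun i => projT1 (cid (H i))).
Qed.

Section CountableTuples.
Context {I : Type} {sg : I -> lsort L}.
Hypothesis I_countable : countable [set: I].
Context (B : set (elt C)) (U : set_system (tup C sg)).
Hypothesis B_small : small K B.
Hypothesis U_proper : ProperFilter U.

(** The tuple [c] lies in the [B]-definable members of [U] that only depend on the
    coordinates in [J]. *)
Let realizes (J : set I) (c : tup C sg) : Prop :=
  forall Z, definable B Z -> depends_on J Z -> U Z -> Z c.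

(** One more coordinate [i] is realized by saturation over [B] and [c]: the
    instances of the type at [c] are finitely satisfiable because the projections
    along [i] of members of [U] are members of [U] not depending on [i]. *)
Let realize_coord (J : set I) (c : tup C sg) (i : I) : realizes J c ->
  exists x : C (sg i), realizes (i |` J) (upd c x).
Proof.
move=> Jc; pose B' := B `|` coords c.
have BB' : B `<=` B' by move=> x; left.
have cB' : coords c `<=` B' by move=> x; right.
have sB' : small K B' by apply: small_setU => //; exact: countable_coords.
pose Phi : set (formula_over B' (fun _ : unit => sg i)) := [set psi | exists Z,
  [/\ definable B Z, depends_on (i |` J) Z, U Z &
      forall y, Z (upd c (y tt)) -> holds y psi]].
have [F finF FPhi|y yPhi] := C_saturated (Phi := Phi) sB'.
  suff [Z [dZ ZJ UZ ZF]] : exists Z, [/\ definable B Z, depends_on (i |` J) Z, U Z &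
      forall y, Z (upd c (y tt)) -> forall psi, F psi -> holds y psi].
    have [|||x Zx] := Jc [set a | exists x : C (sg i), Z (upd a x)].
    - exact: definable_exists.
    - move=> a b ab [x Zx]; exists x; apply: ZJ Zx => j Jj.
      have [ij|ij] := pselect (i = j).
        by case: _ / ij; rewrite !upd_same.
      rewrite !upd_other //; apply: ab.
      by case: Jj => // ji; case: ij.
    - by apply: filterS UZ => a Za; exists (a i); rewrite upd_id.
    exists (fun=> x) => psi Fpsi; exact: ZF.
  move: F finF FPhi; apply: finite_set_ind => [_|psi F IH FPhi].
    exists setT; split=> //; [exact: definableT|exact: filterT].
  have [|Z [dZ ZJ UZ ZF]] := IH; first by move=> x Fx; apply: FPhi; right.
  have [Z' [dZ' Z'J UZ' Z'psi]] : Phi psi by apply: FPhi; left.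
  exists (Z `&` Z'); split; [exact: definableI| |exact: filterI|].
    by move=> a b ab [/(ZJ _ _ ab) ? /(Z'J _ _ ab)].
  by move=> y [/ZF Zy /Z'psi Z'y] x [->|/Zy].
exists (y tt) => Z dZ ZJ UZ.
have [psi /seteqP[Zpsi psiZ]] := definable_section i BB' cB' dZ.
apply: (psiZ y); apply: yPhi; exists Z; split=> // z; exact: Zpsi.
Qed.

(** In a saturated structure, the members of a proper filter on countable tuples
    that are definable over a small set have a common point. It is built one
    coordinate at a time; a definable set only depends on finitely many of them. *)
Lemma realize_filter :
  exists c : tup C sg, forall Z, definable B Z -> U Z -> Z c.
Proof.
have /countable_injP[h /in2TT hI] := I_countable.
pose J n := [set i | (h i < n)%N].
have realS n c : realizes (J n) c ->
    exists c', realizes (J n.+1) c' /\ forall i, h i <> n -> c' i = c i.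
  move=> nc; have [[i hi]|no] := pselect (exists i, h i = n).
    have [x xP] := realize_coord i nc; exists (upd c x); split.
      have <- : i |` J n = J n.+1.
        apply/seteqP; split=> j; rewrite /J /= ltnS.
          by move=> [->|/ltnW//]; rewrite hi.
        by rewrite leq_eqVlt => /orP[/eqP hj|]; [left; apply: hI; rewrite hj|right].
      exact: xP.
    by move=> j hj; apply: upd_other => ij; apply: hj; rewrite -ij.
  exists c; split=> // Z dZ ZJ; apply: nc => // a b ab; apply: ZJ => i.
  rewrite /J /= ltnS leq_eqVlt => /orP[/eqP hi|]; last exact: ab.
  by case: no; exists i.
have [c0] := tup_inhabited sg C.
have real0 : realizes (J 0%N) c0.
  move=> Z dZ ZJ /filter_ex[a]; exact: ZJ.
have /choice[next nextP] : forall nc : nat * tup C sg, exists c',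
    realizes (J nc.1) nc.2 ->
    realizes (J nc.1.+1) c' /\ forall i, h i <> nc.1 -> c' i = nc.2 i.
  move=> [n c] /=; have [nc|nc] := pselect (realizes (J n) c); last by exists c.
  by have [c' c'P] := realS n c nc; exists c'.
pose cs := fix cs n := if n is m.+1 then next (m, cs m) else c0.
have csP n : realizes (J n) (cs n).
  by elim: n => //= n IH; exact: (nextP (n, cs n) IH).1.
pose c : tup C sg := fun i => cs (h i).+1 i.
have cE n i : (h i < n)%N -> c i = cs n i.
  elim: n => // n IH; rewrite ltnS leq_eqVlt => /orP[/eqP <- //|hi].
  rewrite IH //; apply/esym; apply: (nextP (n, cs n) (csP n)).2 => E.
  by rewrite E ltnn in hi.
exists c => Z dZ UZ; have [F finF FZ] := definable_finite_support dZ.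
have [n nF] : exists n, forall i, F i -> (h i < n)%N.
  move: F finF {FZ}; apply: finite_set_ind => [|i F [n nF]]; first by exists 0%N.
  exists (maxn n (h i).+1) => j [->|/nF hj]; rewrite leq_max ?leqnn ?orbT //.
  by rewrite hj.
apply: (FZ (cs n)) => [i Fi|]; first by rewrite (cE n) //; exact: nF.
by apply: csP => // a b ab; apply: FZ => i Fi; apply: ab; exact: nF.
Qed.

End CountableTuples.

(** Tarski-Vaught: a nonempty set definable over an elementary submodel has a
    point all of whose coordinates lie in the submodel. *)
Lemma submodel_point (M : set (elt C)) (I : Type) (sg : I -> lsort L)
    (Z : set (tup C sg)) : elementary_submodel M -> definable M Z -> Z !=set0 ->
  exists2 m, coords m `<=` M & Z m.
Proof.
move=> [N [j [jel ->]]]; set M' := [set _ | _ in _] => dZ Z0.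
have H (c : M') : exists x : N (par_sort c), j _ x = par_tup c.
  case: c => c cM; have [[s x] _ /= cE] := set_mem cM.
  by case: _ / cE cM => cM; exists x.
pose n : tup N (@par_sort _ _ M') := fun c => projT1 (cid (H c)).
have nP : (fun c => j _ (n c)) = @par_tup _ _ M'.
  by apply: functional_extensionality_dep => c; exact: projT2 (cid (H c)).
(* the case of one variable *)
have TV s (Z1 : set (tup C (fun _ : unit => s))) : definable M' Z1 -> Z1 !=set0 ->
    exists x : N s, Z1 (fun=> j _ x).
  move=> [phi ->] [y yphi].
  pose psi : formula (ext_sort (@par_sort _ _ M') s) :=
    subst phi (fun x => match x return term (ext_sort (@par_sort _ _ M') s)
        (sum_sort (fun _ : unit => s) (@par_sort _ _ M') x) with
      | inl _ => Var (ext_sort (@par_sort _ _ M') s) None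
      | inr c => Var (ext_sort (@par_sort _ _ M') s) (Some c)
      end).
  have psiP (x : C s) :
      sat (ext_tup (@par_tup _ _ M') x) psi <-> holds (fun _ : unit => x) phi.
    rewrite /holds sat_subst
      (_ : (fun _ => _) = pair_tup (fun _ : unit => x) (@par_tup _ _ M')) //.
    by apply: functional_extensionality_dep => -[u|c].
  apply: contrapT => nx.
  have : sat n (All (Neg psi)).
    move=> x; rewrite /= => /jel Hx; apply: nx; exists x; apply/psiP.
    rewrite -nP; move: Hx.
    rewrite (_ : (fun _ => _) = ext_tup (fun c => j _ (n c)) (j _ x)) //.
    by apply: functional_extensionality_dep => -[c|].
  move=> /jel; rewrite nP => /(_ (y tt)) /=; apply; apply/psiP.
  by rewrite (_ : (fun=> y tt) = y) //; apply: functional_extensionality_dep => -[].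
have [F finF FZ] := definable_finite_support dZ.
move: F finF Z dZ Z0 FZ; apply: finite_set_ind => [|i F IH] Z dZ [a Za] FZ.
  have [m] := tup_inhabited sg N.
  exists (fun i => j _ (m i)); last by apply: FZ Za.
  by move=> _ [i _ <-]; exists (existT _ _ (m i)).
have [|||m mM [x Zx]] := IH [set a | exists x : C (sg i), Z (upd a x)].
- exact: definable_exists.
- by exists a, (a i); rewrite upd_id.
- move=> b b' bb' [x Zx]; exists x; apply: FZ Zx => k.
  have [ik|ik] := pselect (i = k); first by case: _ / ik; rewrite !upd_same.
  by rewrite !upd_other // => -[ki|/bb'//]; case: ik.
have [|x' Zx'] := TV _ [set y : tup C (fun _ : unit => sg i) | Z (upd m (y tt))]
    (definable_section i (fun _ => id) mM dZ).
  by exists (fun=> x).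
exists (upd m (j _ x')) => // _ [k _ <-].
have [ik|ik] := pselect (i = k).
  by case: _ / ik; rewrite upd_same; exists (existT _ _ x').
by rewrite upd_other //; apply: mM; exists k.
Qed.

(** A complete type over a submodel [M] is the trace on [M]-definable sets of an
    ultrafilter containing the set of tuples of [M]; such an ultrafilter stands
    for a global coheir. *)
Lemma coheir_exists (M : set (elt C)) (I : Type) (sg : I -> lsort L) (a : tup C sg) :
  elementary_submodel M -> exists U : set_system (tup C sg), [/\ UltraFilter U,
    U [set m | coords m `<=` M] & forall Z, definable M Z -> Z a -> U Z].
Proof.
move=> Mel.
pose D := [set Z : set (tup C sg) | definable M Z /\ Z a].
pose F := filter_from D (fun Z => Z `&` [set m | coords m `<=` M]).
have FF : ProperFilter F.
  apply: filter_from_proper; last first.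
    by move=> Z [dZ Za]; have [|m mM Zm] := submodel_point Mel dZ; [exists a|exists m].
  apply: filter_from_filter; first by exists setT; split=> //; exact: definableT.
  move=> Z Z' [dZ Za] [dZ' Z'a]; exists (Z `&` Z').
    by split=> //; exact: definableI.
  by move=> x [[]].
have [U [UU FU]] := ultraFilterLemma FF.
exists U; split=> //.
  by apply: FU; exists setT => [|x []//]; split=> //; exact: definableT.
by move=> Z dZ Za; apply: FU; exists Z => // x [].
Qed.

End Realization.

(** * Bounded invariant relations are coarser than types over a model *)

Section BoundedInvariant.
Context {L : language} {C : structure L} {K : Type}.
Hypothesis K_large : card_lt [set: set nat] [set: K].
Hypothesis C_saturated : saturated C K.
Hypothesis C_homogeneous : strongly_homogeneous C K.
Context {I : Type} {sg : I -> lsort L}.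
Hypothesis I_countable : countable [set: I].

(** The tuple [c] realizes the type over [B] determined by [U]. *)
Definition realizes_over (B : set (elt C)) (U : set_system (tup C sg))
  (c : tup C sg) : Prop := forall Z, definable B Z -> U Z -> Z c.

Lemma realizes_overS B B' U c :
  B `<=` B' -> realizes_over B' U c -> realizes_over B U c.
Proof. by move=> BB' H Z dZ; apply: H; exact: definableS dZ. Qed.

Lemma realizes_overP B U c Z : UltraFilter U -> realizes_over B U c ->
  definable B Z -> U Z <-> Z c.
Proof.
move=> UU Uc dZ; split; first exact: Uc.
move=> Zc; have [//|/Uc] := in_ultra_setVsetC Z UU.
by move=> /(_ (definableC dZ)).
Qed.

(** Realizations over [w] of one ultrafilter have the same type over [w]. *)
Lemma eq_tp_pair_left (U : set_system (tup C sg)) (w c c' : tup C sg) B :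
  UltraFilter U -> coords w `<=` B -> realizes_over B U c -> realizes_over B U c' ->
  tp set0 (pair_tup w c) = tp set0 (pair_tup w c').
Proof.
move=> UU wB Uc Uc'; apply/eq_tpP => Z dZ Zc.
apply: (Uc' [set x | Z (pair_tup w x)]); first exact: definable_pair_left.
by apply/(realizes_overP UU Uc) => //; exact: definable_pair_left.
Qed.

(** A global coheir over [M] is [M]-invariant: were [Z] to distinguish [(a, c)] from
    [(b, c)], it would distinguish [(a, m)] from [(b, m)] for some [m] in [M]. *)
Lemma eq_tp_pair_coheir (M B : set (elt C)) (U : set_system (tup C sg))
    (a b c : tup C sg) :
  UltraFilter U -> U [set m | coords m `<=` M] ->
  coords a `<=` B -> coords b `<=` B -> realizes_over B U c ->
  tp M a = tp M b -> tp set0 (pair_tup a c) = tp set0 (pair_tup b c).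
Proof.
move=> UU UM aB bB Uc /eq_tpP ab; apply/eq_tpP => Z dZ Zac.
apply: contrapT => nZbc.
pose W := [set x | Z (pair_tup a x)] `&` ~` [set x | Z (pair_tup b x)].
have : U W.
  apply/(realizes_overP UU Uc) => //; apply: definableI.
    exact: definable_pair_left.
  by apply: definableC; exact: definable_pair_left.
move=> /(filterI UM)/filter_ex[m [mM [Zam nZbm]]]; apply: nZbm.
apply: (ab [set x | Z (pair_tup x m)]) => //.
exact: definable_pair_right.
Qed.

Context {X : set (tup C sg)} {E : tup C sg -> set (tup C sg)}.
Hypothesis E_equivalence : equivalence_on X E.
Hypothesis E_invariant : invariant (graph E).

Lemma rel_act (f : forall s, C s -> C s) (a b : tup C sg) :
  automorphism f -> E a b -> E (act f a) (act f b).
Proof.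
move=> /E_invariant H ab; have [|a' [b' [a'b' pE]]] := H (act f (pair_tup a b)).
  by exists (pair_tup a b) => //; exists a, b.
have -> : act f a = a'.
  apply: functional_extensionality_dep => i.
  exact: (congr1 (fun t : tup C (sum_sort sg sg) => t (inl i)) pE).
have -> // : act f b = b'.
apply: functional_extensionality_dep => i.
exact: (congr1 (fun t : tup C (sum_sort sg sg) => t (inr i)) pE).
Qed.

Lemma rel_tp (a b a' b' : tup C sg) :
  tp set0 (pair_tup a b) = tp set0 (pair_tup a' b') -> E a b -> E a' b'.
Proof.
move=> tpE ab; have sII : small K [set: I + I].
  by apply: small_countable => //; exact: countable_setT_sum.
have [f autf fE] := C_homogeneous sII tpE.
have -> : a' = act f a.
  apply: functional_extensionality_dep => i.
  exact: (esym (congr1 (fun t : tup C (sum_sort sg sg) => t (inl i)) fE)).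
have -> : b' = act f b.
  apply: functional_extensionality_dep => i.
  exact: (esym (congr1 (fun t : tup C (sum_sort sg sg) => t (inr i)) fE)).
exact: rel_act.
Qed.

Hypothesis X_type_definable : type_definable X.
Hypothesis E_bounded : bounded_rel K X E.

(** Let [c] realize a global coheir [U] of [tp M a] over representatives of all
    classes, so that [E c w] for one representative [w], and let [c'] realize
    [U] over [w] and [c].  Then [E c' w], so [E c c']; by invariance of [U],
    [E a c'] and [E b c'] follow. *)
Lemma eq_tp_model_rel (M : set (elt C)) (a b : tup C sg) :
  elementary_submodel M -> countable M -> X a -> tp M a = tp M b -> E a b.
Proof.
move=> Mel Mc Xa ab; have [EX Erefl Esym Etrans] := E_equivalence.
have [U [UU UM Ua]] := coheir_exists a Mel.
have /choice[r rP] : forall D, exists d, classes X E D -> D d.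
  move=> D; have [[x Xx <-]|nD] := pselect (classes X E D); last by exists a.
  by exists x => _; exact: Erefl.
(* smallness of [B0] is where boundedness enters *)
pose B0 := \bigcup_(D in classes X E) coords (r D).
have sB0 : small K B0.
  by apply: small_bigcup_countable => // D; exact: countable_coords.
have [c cP] : exists c, realizes_over (B0 `|` M) U c.
  by apply: (realize_filter K_large C_saturated I_countable) => //; exact: small_setU.
have Xc : X c.
  have [Phi XE] := X_type_definable; rewrite XE => phi Phiphi.
  have dphi : definable set0 [set x : tup C sg | holds x phi] by exists phi.
  apply: (cP [set x | holds x phi]); first exact: definableS dphi.
  apply: Ua; first exact: definableS dphi.
  by move: Xa; rewrite XE; exact.
have Ec : classes X E (E c) by exists c.
pose w := r (E c); have Ecw : E c w by exact: rP.
have wB0 : coords w `<=` B0 by move=> x wx; exists (E c).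
pose N := coords c `|` (coords a `|` coords b).
have [c' c'P] : exists c', realizes_over (B0 `|` N) U c'.
  apply: (realize_filter K_large C_saturated I_countable) => //; apply: small_setU => //.
  by do 2?[apply: countable_setU]; exact: countable_coords.
have Ecc' : E c c'.
  apply: (Etrans _ _ _ Ecw); apply: (rel_tp _ (Esym _ _ Ecw)).
  apply: (eq_tp_pair_left UU wB0).
    by apply: realizes_overS cP => x; left.
  by apply: realizes_overS c'P => x; left.
have ac : tp M a = tp M c.
  apply/eq_tpP => Z dZ Za; apply: cP; last exact: Ua.
  by apply: definableS dZ => x; right.
have to_c' d : coords d `<=` N -> tp M d = tp M c -> E d c'.
  move=> dN dc; apply: (rel_tp _ Ecc').
  apply: (eq_tp_pair_coheir UU UM _ dN _ (esym dc)); first by move=> x; left.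
  by apply: realizes_overS c'P => x; right.
apply: (Etrans _ _ _ (to_c' a _ ac)); first by move=> x; right; left.
by apply/Esym/to_c'; [move=> x; right; right|rewrite -ab].
Qed.

End BoundedInvariant.

(** * Minimal flows of ultrafilters *)

Lemma ultrafilter_of_decide {V : Type} (F : set_system V) : ProperFilter F ->
  (forall W, F W \/ F (~` W)) -> UltraFilter F.
Proof.
move=> FF Fdec; split=> // G GG FG; apply/seteqP; split=> // W GW.
have [//|/FG GnW] := Fdec W.
by have [x []] := filter_ex (filterI GW GnW).
Qed.

Lemma filter_bigcap_finite {V : Type} (U : set_system V) (F : set (set V)) :
  Filter U -> finite_set F -> F `<=` U -> U (\bigcap_(W in F) W).
Proof.
move=> UF; move: F; apply: finite_set_ind => [_|W F IH FU].
  by rewrite bigcap_set0; exact: filterT.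
rewrite bigcap_setU1; apply: filterI; first by apply: FU; left.
by apply: IH => x Fx; apply: FU; right.
Qed.

(** The finite intersection property. *)
Definition fip {V : Type} (Q : set (set V)) : Prop :=
  forall F : set (set V), finite_set F -> F `<=` Q -> \bigcap_(W in F) W !=set0.

Lemma fip_ultrafilter {V : Type} (Q : set (set V)) : fip Q ->
  exists U : set_system V, UltraFilter U /\ Q `<=` U.
Proof.
move=> Qfip; pose F := filter_from [set F : set (set V) | finite_set F /\ F `<=` Q]
  (fun F => \bigcap_(W in F) W).
have FF : ProperFilter F.
  apply: filter_from_proper; last by move=> A [finA AQ]; exact: Qfip.
  apply: filter_from_filter; first by exists set0; split.
  move=> A B [finA AQ] [finB BQ]; exists (A `|` B).
    by rewrite /= finite_setU; split=> // x [/AQ|/BQ].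
  by rewrite bigcap_setU.
have [U [UU FU]] := ultraFilterLemma FF; exists U; split=> // W QW.
by apply: FU; exists [set W]; [split=> // _ ->|rewrite bigcap_set1].
Qed.

(** The closed subspace of the space of ultrafilters on [V] consisting of the
    ultrafilters that contain [Q]. *)
Definition ultra_space {V : Type} (Q : set (set V)) : Type :=
  {U : set_system V | UltraFilter U /\ Q `<=` U}.

Section UltraSpace.
Context {V : Type} {Q : set (set V)}.
Implicit Types U : ultra_space Q.

HB.instance Definition _ := gen_eqMixin (ultra_space Q).
HB.instance Definition _ := gen_choiceMixin (ultra_space Q).

(** The topology generated by the clopen sets of ultrafilters containing a given
    set. *)
Definition ultra_open (O : set (ultra_space Q)) : Prop :=
  forall U, O U -> exists2 W, sval U W & forall U', sval U' W -> O U'.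

Let ultra_openT : ultra_open setT.
Proof. by move=> [U [UU QU]] _; exists setT => //=; exact: filterT. Qed.

Let ultra_openI : setI_closed ultra_open.
Proof.
move=> O O' oO oO' U [/oO[W UW WO] /oO'[W' UW' W'O']].
exists (W `&` W'); first by case: (svalP U) => UU _; exact: filterI.
move=> U' U'WW'; case: (svalP U') => UU' _.
by split; [apply: WO|apply: W'O']; apply: filterS U'WW' => x [].
Qed.

Let ultra_open_bigU (I : Type) (f : I -> set (ultra_space Q)) :
  (forall i, ultra_open (f i)) -> ultra_open (\bigcup_i f i).
Proof.
move=> fo U [i _ /(fo i)[W UW WO]]; exists W => // U' /WO fU'; by exists i.
Qed.

HB.instance Definition _ := isOpenTopological.Build (ultra_space Q)
  ultra_openT ultra_openI ultra_open_bigU.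

Lemma ultra_openE (O : set (ultra_space Q)) : open O = ultra_open O.
Proof. by []. Qed.

Lemma ultra_space_ext U U' : (forall W, sval U W <-> sval U' W) -> U = U'.
Proof.
case: U U' => U pU [U' pU'] /= UU'.
have E : U = U' by apply/funext => W; exact/propext.
move: pU pU'; rewrite E => pU pU'; congr exist; exact: Prop_irrelevance.
Qed.

Lemma open_basic (W : set V) : open [set U : ultra_space Q | sval U W].
Proof. by rewrite ultra_openE => U UW; exists W. Qed.

Lemma ultra_notin U (W : set V) : ~ sval U W <-> sval U (~` W).
Proof.
case: (svalP U) => UU _; split=> [nUW|UnW UW].
  by have [] := in_ultra_setVsetC W UU.
by have [x []] := filter_ex (filterI UW UnW).
Qed.

Lemma closed_basic (W : set V) : closed [set U : ultra_space Q | sval U W].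
Proof.
rewrite (_ : [set U : ultra_space Q | sval U W] =
    ~` [set U : ultra_space Q | sval U (~` W)]).
  by apply: open_closedC; exact: open_basic.
apply/seteqP; split=> U /=; first by move=> UW /ultra_notin.
by move=> nUnW; apply: contrapT => /ultra_notin.
Qed.

(** The Baire category theorem: the members of a decreasing sequence of sets
    chosen so as to avoid countably many nowhere dense sets lie in one common
    ultrafilter. *)
Lemma ultra_space_nonmeager : fip Q -> ~ meager [set: ultra_space Q].
Proof.
move=> Qfip [NN [cNN NN_nd cov]].
have [N [Nnd Ncov]] : exists N : nat -> set (ultra_space Q),
    (forall n, nowhere_dense (N n)) /\ forall U, exists n, N n U.
  move: cNN => /pfcard_geP[NN0|[e]].
    have [U0 [UU0 QU0]] := fip_ultrafilter Qfip.
    have [N] := cov (exist _ U0 (conj UU0 QU0)) I.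
    by rewrite NN0.
  exists e; split=> [n|U]; first by apply: NN_nd; exact: funS.
  have [N NN_N NU] := cov U I; have [n _ nN] := @surj _ _ _ _ e N NN_N.
  by exists n; rewrite nN.
pose ok W := exists U : ultra_space Q, sval U W.
have /choice[next nextP] : forall u : nat * set V, exists W', ok u.2 ->
    [/\ ok W', W' `<=` u.2 & forall U, sval U W' -> ~ N u.1 U].
  move=> [n W] /=; have [[U UW]|nok] := pselect (ok W); last by exists setT.
  have [|O' [oO' [U' O'U'] O'W O'N]] := Nnd n _ (@open_basic W).
    by exists U.
  have [W' U'W' W'O'] := oO' U' O'U'.
  case: (svalP U') => UU' _; exists (W `&` W') => _; split.
  - by exists U'; apply: filterI => //; exact: O'W.
  - exact: subIsetl.
  - move=> U1 U1W NU1; suff : set0 U1 by []; rewrite -O'N; split=> //.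
    by apply: W'O'; case: (svalP U1) => UU1 _; apply: filterS U1W => x [].
pose Ws := fix Ws n := if n is m.+1 then next (m, Ws m) else setT.
have okW n : ok (Ws n).
  elim: n => [|n IH]; last by have [] := nextP (n, Ws n) IH.
  have [U0 [UU0 QU0]] := fip_ultrafilter Qfip.
  by exists (exist _ U0 (conj UU0 QU0)) => /=; exact: filterT.
have WsS n m : (n <= m)%N -> Ws m `<=` Ws n.
  move=> /subnK <-; elim: (m - n)%N => [//|k IH]; rewrite addSn.
  by apply: subset_trans IH; have [] := nextP (k + n, Ws (k + n))%N (okW _).
have [F finF FQ|U [UU QU]] := @fip_ultrafilter V (Q `|` range Ws).
  have [n nP] : exists n, forall W, F W -> Q W \/ Ws n `<=` W.
    move: F finF FQ; apply: finite_set_ind => [_|W F IH FQ]; first by exists 0%N.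
    have [|n nP] := IH; first by move=> x Fx; apply: FQ; right.
    have [QW|[k _ kW]] := FQ W (or_introl erefl).
      by exists n => x [->|/nP//]; left.
    exists (maxn n k) => x [->|/nP[Qx|nx]]; [right|by left|right].
      by rewrite -kW; apply: WsS; exact: leq_maxr.
    by apply: subset_trans nx; apply: WsS; exact: leq_maxl.
  have [[U [UU QU]] /= UW] := okW n.
  apply: (@filter_ex _ U); apply: filter_bigcap_finite => // W /nP[/QU//|nW].
  exact: filterS UW.
pose U' : ultra_space Q := exist _ U (conj UU (subset_trans (@subsetUl _ _ _) QU)).
have [n nU] := Ncov U'.
have [_ _ /(_ U')] := nextP (n, Ws n) (okW n); apply => //=.
by apply: (QU); right; exists n.+1.
Qed.

End UltraSpace.

Section MinimalFlow.
Context {V : Type} (H : set (V -> V)) (D : set V).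
Hypothesis H_id : H id.
Hypothesis H_comp : forall g h, H g -> H h -> H (g \o h).
Hypothesis H_inv : forall h, H h -> exists h', [/\ H h', cancel h h' & cancel h' h].
Hypothesis H_D : forall h x, H h -> D x -> D (h x).
Hypothesis D_nonempty : D !=set0.

(** [H]-invariant families of sets which, together with [D], have the finite
    intersection property: they present the nonempty closed [H]-invariant sets
    of ultrafilters containing [D]. *)
Definition invariant_fip (P : set (set V)) : Prop :=
  fip (D |` P) /\ forall h W, H h -> P W -> P (h @^-1` W).

(** A maximal invariant family presents a minimal flow. *)
Lemma maximal_invariant_fip : exists P, invariant_fip P /\
  forall P', P `<=` P' -> invariant_fip P' -> P' `<=` P.
Proof.
have [F FP Ftot|P [iP Pmax]] := @Zorn_bigcup _ invariant_fip; last first.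
  exists P; split=> // P' PP' iP'; apply: contrapT => nP'P.
  exact: (Pmax P').
split; last first.
  move=> h W Hh [P FPP PW]; exists P => //; exact: (FP P FPP).2.
move=> A finA AD.
have [AD1|[P FPP AP]] : A `<=` [set D] \/ exists2 P, F P & A `<=` D |` P.
- move: A finA AD; apply: finite_set_ind => [_|W A IH AD]; first by left.
  have {}IH := IH (fun x Ax => AD x (or_intror Ax)).
  have [->|[P FPP PW]] := AD W (or_introl erefl).
    case: IH => [AD1|[P FPP AP]]; first by left=> x [->|/AD1].
    by right; exists P => // x [->|/AP//]; left.
  right; case: IH => [AD1|[P' FP' AP']].
    by exists P => // x [->|/AD1 ->]; [right|left].
  have [PP'|P'P] := Ftot _ _ FPP FP'.
    by exists P' => // x [->|/AP'//]; right; exact: PP'.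
  by exists P => // x [->|/AP'[->|/P'P]]; [right|left|right].
- have [d Dd] := D_nonempty; exists d => W /AD1 ->; exact: Dd.
- exact: (FP P FPP).1.
Qed.

Context (P : set (set V)).
Hypothesis P_invariant : invariant_fip P.
Hypothesis P_maximal : forall P', P `<=` P' -> invariant_fip P' -> P' `<=` P.

Notation S := (ultra_space (D |` P)).

(** Finitely many translates of a nonempty basic open set cover: otherwise adding to
    [P] the complements of all the translates of [W] would contradict the
    maximality of [P]. *)
Lemma minimal_flow_cover (W : set V) : (exists U : S, sval U W) ->
  exists F : set (V -> V), [/\ finite_set F, F `<=` H &
    forall U : S, exists2 h, F h & sval U (h @^-1` W)].
Proof.
move=> [U0 U0W]; apply: contrapT => nF.
pose P' := P `|` [set ~` (h @^-1` W) | h in H].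
have PP' : P `<=` P' by move=> x; left.
have iP' : invariant_fip P'.
  split.
    move=> A finA AP'.
    have [F [finF FH FA]] : exists F : set (V -> V), [/\ finite_set F, F `<=` H &
        forall W', A W' -> (D |` P) W' \/ exists2 h, F h & W' = ~` (h @^-1` W)].
      move: A finA AP'; apply: finite_set_ind => [_|W' A IH AP'].
        by exists set0; split=> //; exact: sub0set.
      have [F [finF FH FA]] := IH (fun x Ax => AP' x (or_intror Ax)).
      have [W'D|[PW'|[h Hh hW']]] := AP' W' (or_introl erefl).
      - by exists F; split=> // x [->|/FA//]; left; left.
      - by exists F; split=> // x [->|/FA//]; left; right.
      exists (h |` F); split; first by rewrite finite_setU; split=> //; exact: finite_set1.
        by move=> x [->|/FH].
      move=> x [->|/FA[?|[g Fg gx]]]; [right|by left|right].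
        by exists h => //; left.
      by exists g => //; right.
    have [U nU] : exists U : S, forall h, F h -> ~ sval U (h @^-1` W).
      apply: contrapT => nU; apply: nF; exists F; split=> // U.
      apply: contrapT => nh; apply: nU; exists U => h Fh Uh; apply: nh.
      by exists h.
    case: (svalP U) => UU QU; apply: (@filter_ex _ (sval U)).
    apply: filter_bigcap_finite => // W' /FA[/QU//|[h Fh ->]].
    by apply/ultra_notin; exact: nU.
  move=> h W' Hh [PW'|[g Hg <-]]; first by left; exact: P_invariant.2.
  by right; exists (g \o h); [exact: H_comp|].
have PnW : P (~` W).
  by apply: (P_maximal PP' iP'); right; exists id.

suff : sval U0 (~` W) by move=> /ultra_notin.
by case: (svalP U0) => _; apply; right.
Qed.

(** The map [phi] is the action of [h] on ultrafilters by pushing forward. *)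
Definition pushes (h : V -> V) (phi : S -> S) : Prop :=
  forall U W, sval (phi U) W <-> sval U (h @^-1` W).

Lemma pushes_exists (h : V -> V) : H h -> exists phi : S -> S, pushes h phi.
Proof.
move=> Hh; suff /choice[phi phiP] : forall U : S, exists U' : S,
    forall W, sval U' W <-> sval U (h @^-1` W) by exists phi.
move=> [U [UU QU]]; pose U' : set_system V := [set W | U (h @^-1` W)].
have U'U : UltraFilter U'.
  apply: ultrafilter_of_decide => W.
  exact: (in_ultra_setVsetC (h @^-1` W) UU).
have QU' : D |` P `<=` U'.
  move=> W [->|PW]; last by apply: QU; right; exact: P_invariant.2.
  by apply: (@filterS _ U _ D); [move=> x; exact: H_D|apply: QU; left].
by exists (exist _ U' (conj U'U QU')).
Qed.

Lemma pushes_continuous (h : V -> V) (phi : S -> S) : pushes h phi -> continuous phi.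
Proof.
move=> hphi; apply/continuousP => O; rewrite !ultra_openE => oO U /oO[W UW WO].
exists (h @^-1` W); first exact/hphi.
by move=> U' /hphi/WO.
Qed.

Lemma pushes_cancel (h h' : V -> V) (phi phi' : S -> S) :
  cancel h h' -> pushes h phi -> pushes h' phi' -> cancel phi phi'.
Proof.
move=> hK hphi hphi' U; apply: ultra_space_ext => W.
rewrite hphi' hphi (_ : h @^-1` (h' @^-1` W) = W) //.
by apply/seteqP; split=> x /=; rewrite hK.
Qed.

Lemma minimal_flow_minimal :
  minimal_action [set phi : S -> S | exists2 h, H h & pushes h phi].
Proof.
split=> [phi [h Hh hphi]|O oO [U OU]].
  have [h' [Hh' hK h'K]] := H_inv Hh; have [phi' hphi'] := pushes_exists Hh'.
  exists phi'; split.
  - exact: pushes_continuous hphi.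
  - exact: pushes_continuous hphi'.
  - exact: pushes_cancel hK hphi hphi'.
  - exact: pushes_cancel h'K hphi' hphi.
have [W UW WO] : exists2 W, sval U W & forall U', sval U' W -> O U' by exact: oO.
have [F [finF FH Fcov]] : exists F : set (V -> V), [/\ finite_set F, F `<=` H &
    forall U : S, exists2 h, F h & sval U (h @^-1` W)].
  by apply: minimal_flow_cover; exists U.
have /choice[push pushP] : forall h, exists phi : S -> S, H h -> pushes h phi.
  move=> h; have [Hh|nHh] := pselect (H h); last by exists id.
  by have [phi hphi] := pushes_exists Hh; exists phi.
exists (push @` F); split; first exact: finite_image.
  by move=> _ [h /FH Hh <-]; exists h => //; exact: pushP.
move=> U'; have [h Fh U'h] := Fcov U'; exists (push h); first by exists h.
by apply: WO; apply/pushP => //; exact: FH.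
Qed.

End MinimalFlow.

(** * Normal forms *)

Section NormalForm.
Context {L : language} {C : structure L} {I : Type} {sg : I -> lsort L}.
Context {R : realType} {X : set (tup C sg)} {E : tup C sg -> set (tup C sg)}.
Context {Phi : nat -> set (formula_over (C := C) set0 (sum_sort sg sg))}.
Hypothesis Phi_nf : normal_form R Phi X E.

Lemma nf_mono n m (u : tup C (sum_sort sg sg)) : (n <= m)%N ->
  solutions (Phi n) u -> solutions (Phi m) u.
Proof.
have [_ _ S _ _] := Phi_nf.
by move=> /subnK <-; elim: (m - n)%N => // k IH /IH; rewrite addSn; exact: S.
Qed.

(** The infimum defining the distance is attained. *)
Lemma nf_distP n (a b : tup C sg) :
  (nf_dist R Phi a b <= n%:R%:E)%E <-> solutions (Phi n) (pair_tup a b).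
Proof.
split=> [|H]; last by apply: ereal_inf_lbound; exists n.
apply: contraPP => nH; apply/negP; rewrite -ltNge.
apply: (@lt_le_trans _ _ (n.+1%:R%:E)); first by rewrite lte_fin ltr_nat.
apply/ereal_infP => _ [k /= Hk <-]; rewrite lee_fin ler_nat ltnNge.
by apply/negP => /nf_mono/(_ Hk).
Qed.

Lemma nf_sym n (a b : tup C sg) :
  solutions (Phi n) (pair_tup a b) -> solutions (Phi n) (pair_tup b a).
Proof.
have [_ PX _ _ [_ S _]] := Phi_nf.
by move=> H; have [Xa Xb] := PX _ _ _ H; apply/nf_distP; rewrite S //; exact/nf_distP.
Qed.

Lemma nf_trans n m (a b c : tup C sg) : solutions (Phi n) (pair_tup a b) ->
  solutions (Phi m) (pair_tup b c) -> solutions (Phi (n + m)%N) (pair_tup a c).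
Proof.
have [_ PX _ _ [_ _ T]] := Phi_nf.
move=> Hn Hm; have [Xa Xb] := PX _ _ _ Hn; have [_ Xc] := PX _ _ _ Hm.
apply/nf_distP; apply: le_trans (T _ b _ Xa Xb Xc) _.
by rewrite natrD EFinD; apply: leeD; exact/nf_distP.
Qed.

Lemma nf_diameter_le n (D : set (tup C sg)) :
  (forall a b, D a -> D b -> solutions (Phi n) (pair_tup a b)) ->
  (diameter R Phi D <= n%:R%:E)%E.
Proof.
move=> H; apply/ereal_supP => _ [[a b] [/= Da Db] <-].
by apply/nf_distP; exact: H.
Qed.

End NormalForm.

(** * Automorphisms *)

Section Automorphisms.
Context {L : language} {C : structure L}.

Lemma eval_act (f : forall s, C s -> C s) (I : Type) (sg : I -> lsort L)
    (a : tup C sg) (s : lsort L) (t : term sg s) :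
  automorphism f -> eval (act f a) t = f s (eval a t).
Proof.
move=> [_ ffun _]; elim: t => //= g args IH; rewrite ffun; congr (fun_int C g _).
by apply: functional_extensionality_dep => k; exact: IH.
Qed.

Lemma sat_act (f : forall s, C s -> C s) (I : Type) (sg : I -> lsort L)
    (phi : formula sg) (a : tup C sg) :
  automorphism f -> sat (act f a) phi <-> sat a phi.
Proof.
move=> autf; have [fbij _ frel] := autf.
elim: phi a => {I sg} [I sg|I sg s t u|I sg r args|I sg phi IHphi psi IHpsi|
  I sg s phi IH] a //=.
- rewrite !eval_act //; split=> [|->//]; exact: (bij_inj (fbij s)).
- rewrite (_ : (fun k => eval (act f a) (args k)) = act f (fun k => eval a (args k))).
    by rewrite -frel.
  by apply: functional_extensionality_dep => k; exact: eval_act.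
- by rewrite IHphi IHpsi.
- have E x : ext_tup (act f a) (f s x) = act f (ext_tup a x).
    by apply: functional_extensionality_dep => -[i|].
  split=> H x; first by apply/IH; rewrite -E; exact: H.
  have [g fK gK] := fbij s; rewrite -(gK x) E; apply/IH; exact: H.
Qed.

(** The preimage of a [B]-definable set under an automorphism is definable over
    the preimages [b] of the elements of [B]. *)
Lemma definable_act (f : forall s, C s -> C s) (B : set (elt C)) : automorphism f ->
  exists b : tup C (@par_sort _ _ B), forall (I : Type) (sg : I -> lsort L)
    (Z : set (tup C sg)), definable B Z -> definable (coords b) (act f @^-1` Z).
Proof.
move=> autf; have [fbij _ _] := autf.
have H (c : B) : exists y, f _ y = par_tup c.
  by have [g _ gK] := fbij (par_sort c); exists (g (par_tup c)).
pose b : tup C (@par_sort _ _ B) := fun c => projT1 (cid (H c)).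
have bP : act f b = @par_tup _ _ B.
  by apply: functional_extensionality_dep => c; exact: projT2 (cid (H c)).
exists b => I sg Z [phi ->].
have /(definable_pair_right (@subset_refl _ (coords b))) :
    definable set0 [set u : tup C (sum_sort sg (@par_sort _ _ B)) | sat u phi].
  exists (subst phi (fun x =>
    Var (sum_sort (sum_sort sg (@par_sort _ _ B)) (@par_sort _ _ set0)) (inl x))).
  by apply/funext => u; apply/propext; rewrite /holds /= sat_subst.
rewrite (_ : mkset _ = act f @^-1` [set a | holds a phi]) //.
apply/funext => a; apply/propext; rewrite /= /holds -bP -(sat_act phi _ autf).
rewrite (_ : act f (pair_tup a b) = pair_tup (act f a) (act f b)) //.
by apply: functional_extensionality_dep => -[i|c] /=.
Qed.

Lemma holds_pair_act (f : forall s, C s -> C s) (I J : Type) (sg : I -> lsort L)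
    (tg : J -> lsort L) (phi : formula_over (C := C) set0 (sum_sort sg tg))
    (a : tup C sg) (b : tup C tg) :
  automorphism f ->
  holds (pair_tup (act f a) (act f b)) phi <-> holds (pair_tup a b) phi.
Proof.
move=> autf; rewrite /holds -(sat_act phi (pair_tup (pair_tup a b) _) autf).
suff -> : pair_tup (pair_tup (act f a) (act f b)) (@par_tup _ C set0) =
  act f (pair_tup (pair_tup a b) (@par_tup _ C set0)) by [].
apply: functional_extensionality_dep => -[[i|j]|c] //.
by case: c => c c0; have := set_mem c0.
Qed.

End Automorphisms.

(** * Classes of bounded diameter *)

(** The class [E d0] is contained in [Y], and the group [G] preserves the classes
    inside the type of [d0] and acts transitively on each of them. *)
Section OrbitalClass.
Context {R : realType} {L : language} {C : structure L} {K : Type}.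
Hypothesis K_large : card_lt [set: set nat] [set: K].
Hypothesis C_saturated : saturated C K.
Hypothesis C_homogeneous : strongly_homogeneous C K.
Context {I : Type} {sg : I -> lsort L}.
Hypothesis I_countable : countable [set: I].
Context {X : set (tup C sg)} {E : tup C sg -> set (tup C sg)} {Y : set (tup C sg)}.
Hypothesis X_type_definable : type_definable X.
Hypothesis E_equivalence : equivalence_on X E.
Hypothesis E_bounded : bounded_rel K X E.
Hypothesis E_invariant : invariant (graph E).
Hypothesis Y_sub : Y `<=` X.
Hypothesis Y_pseudo_closed : pseudo_closed K Y.
Context {d0 : tup C sg}.
Hypothesis d0_Y : E d0 `<=` Y.
Hypothesis E_tp : forall a b, E a b -> tp set0 a = tp set0 b.
Context {G : set (forall s, C s -> C s)}.
Hypothesis G_group : aut_group G.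
Hypothesis G_class : forall g a, X a -> tp set0 a = tp set0 d0 -> G g -> E a (act g a).
Hypothesis G_transitive : forall a b, tp set0 a = tp set0 d0 -> E a b ->
  exists2 g, G g & act g a = b.
Hypothesis d0_X : X d0.

Let H : set (tup C sg -> tup C sg) := [set act g | g in G].

Lemma group_inverse (g : forall s, C s -> C s) : G g -> exists g', [/\ G g',
  forall a : tup C sg, act g' (act g a) = a &
  forall a : tup C sg, act g (act g' a) = a].
Proof.
move=> Gg; have [Gaut Gid Gcomp Ginv] := G_group.
have [gbij _ _] := Gaut g Gg.
have Hs s : exists g', cancel (g s) g' /\ cancel g' (g s).
  by have [g' gK g'K] := gbij s; exists g'.
pose g' s := projT1 (cid (Hs s)).
have gK s : cancel (g s) (g' s) by exact: (projT2 (cid (Hs s))).1.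
have g'K s : cancel (g' s) (g s) by exact: (projT2 (cid (Hs s))).2.
exists g'; split; first exact: Ginv Gg gK g'K.
  by move=> a; apply: functional_extensionality_dep => i; exact: gK.
by move=> a; apply: functional_extensionality_dep => i; exact: g'K.
Qed.

Let H_id : H id.
Proof. by have [_ Gid _ _] := G_group; exists (fun=> id). Qed.

Let H_comp g h : H g -> H h -> H (g \o h).
Proof.
have [_ _ Gcomp _] := G_group.
by move=> [f Gf <-] [k Gk <-]; exists (fun s => f s \o k s) => //; exact: Gcomp.
Qed.

Let H_inv h : H h -> exists h', [/\ H h', cancel h h' & cancel h' h].
Proof.
move=> [g Gg <-]; have [g' [Gg' gK g'K]] := group_inverse Gg.
by exists (act g'); split=> //; exists g'.
Qed.

Let H_D h x : H h -> E d0 x -> E d0 (h x).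
Proof.
have [EX _ _ Etrans] := E_equivalence.
move=> [g Gg <-] Ex; apply: (Etrans _ _ _ Ex); apply: G_class => //.
  by have [] := EX _ _ Ex.
by rewrite -(E_tp Ex).
Qed.

Section Flow.
Context {P : set (set (tup C sg))}.
Hypothesis P_invariant : invariant_fip H (E d0) P.
Hypothesis P_maximal : forall P', P `<=` P' -> invariant_fip H (E d0) P' -> P' `<=` P.

Notation S := (ultra_space (E d0 |` P)).

Let S_ultra (U : S) : UltraFilter (sval U).
Proof. by case: (svalP U). Qed.

(** Types of ultrafilters of the flow over countable sets are realized in [Y]. *)
Lemma flow_realize (B : set (elt C)) (U : S) : countable B ->
  exists c, [/\ realizes_over B (sval U) c, Y c & tp set0 c = tp set0 d0].
Proof.
move=> cB; have [A sA [Psi YE]] := Y_pseudo_closed.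
have [UU QU] := svalP U; have UD : sval U (E d0) by apply: QU; left.
have [c cP] : exists c, realizes_over (A `|` B) (sval U) c.
  apply: (realize_filter K_large C_saturated I_countable); first exact: small_setU.
exists c; split; first by apply: realizes_overS cP => x; right.
  rewrite YE => psi Ppsi; apply: (cP [set x | holds x psi]).
    apply: (@definableS _ _ A) => [x|]; [by left|by exists psi].
  by apply: (filterS _ UD) => x /d0_Y; rewrite YE; exact.
apply/esym/eq_tpP => Z dZ Zd0; apply: cP; first exact: definableS dZ.
apply: (filterS _ UD) => x /E_tp/eq_tpP; exact.
Qed.

(** If the relation induced on types over [M] is smooth, then comeagerly many
    ultrafilters of the flow are realized over [M] in one and the same class. *)
Lemma flow_comeager_rel (M : set (elt C)) (PT : completePseudoMetricType R)
    (f : types_of M Y -> PT) : elementary_submodel M -> countable M -> polish PT ->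
  borel_fun f -> (forall p q, type_rel E (sval p) (sval q) <-> f p = f q) ->
  exists G0 : set S, meager (~` G0) /\ forall U U', G0 U -> G0 U' -> forall c c',
    realizes_over M (sval U) c -> realizes_over M (sval U') c' -> X c -> X c' -> E c c'.
Proof.
move=> Mel Mc PTp fB fE; have [EX _ Esym Etrans] := E_equivalence.
have /choice[c cP] : forall U : S, exists c,
    [/\ realizes_over M (sval U) c, Y c & tp set0 c = tp set0 d0].
  by move=> U; exact: flow_realize.
have rY U : types_of M Y (tp M (c U)) by exists (c U) => //; have [] := cP U.
pose r U : types_of M Y := exist _ (tp M (c U)) (mem_set (rY U)).
have rP U x : realizes_over M (sval U) x -> tp M x = tp M (c U).
  move=> Ux; apply/eq_tpP => Z dZ /(realizes_overP (S_ultra U) Ux dZ).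
  by have [+ _ _] := cP U; apply.
(* [r] sends an ultrafilter to its type over [M]. *)
have rc : continuous r.
  apply/continuousP => _ [ O oO <-]; rewrite ultra_openE => U /= OU.
  have [F [finF Fp FO]] := ctype_open_nbhs oO OU.
  have [cU _ _] := cP U; have UU := S_ultra U.
  exists (\bigcap_(W in [set [set x | holds x phi] | phi in F]) W).
    apply: filter_bigcap_finite; first exact: finite_image.
    move=> _ [phi /Fp Hphi <-].
    by apply/(realizes_overP (S_ultra U) cU) => //; exists phi.
  move=> U' HU'; apply: FO => phi Fphi /=.
  have [cU' _ _] := cP U'; have UU' := S_ultra U'.
  apply: (cU' [set x | holds x phi]); first by exists phi.
  by apply: filterS HU' => x; apply; exists phi.
have E_model a b : X a -> tp M a = tp M b -> E a b.
  exact: (eq_tp_model_rel K_large C_saturated C_homogeneous I_countable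
    E_equivalence E_invariant X_type_definable E_bounded).
(* [f \o r] is invariant, since [G] preserves classes. *)
have fr_inv phi : [set phi | exists2 h, H h & pushes h phi] phi ->
    forall U, f (r (phi U)) = f (r U).
  move=> [_ [g Gg <-] gphi] U; apply/fE; rewrite /type_rel /=.
  have [Gaut _ _ _] := G_group.
  have [b bP] := definable_act M (Gaut g Gg).
  have [|x [Ux Yx xd0]] := @flow_realize (M `|` coords b) U.
    apply: countable_setU => //; apply: countable_coords.
    by rewrite (eq_countable (card_setT M)).
  have EX' : E x (act g x) by apply: G_class => //; exact: Y_sub.
  exists (act g x), x; split; last exact: Esym.
    apply: rP => Z dZ /gphi; apply: (Ux (act g @^-1` Z)).
    by apply: definableS (bP _ _ _ dZ) => y; right.
  by apply: rP; apply: realizes_overS Ux => y; left.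
have [G0 [mG0 G0f]] : exists G0 : set S, meager (~` G0) /\
    forall U U', G0 U -> G0 U' -> f (r U) = f (r U').
  apply: comeager_constant => // B oB.
  apply: (invariant_meager_or_comeager (minimal_flow_minimal H_id H_comp H_inv H_D
    P_invariant P_maximal)).
  - move=> phi /fr_inv fphi; apply/seteqP; split=> U /=; by rewrite fphi.
  - apply: (@borel_preimage_baire_property _ _ r (f @^-1` B)) => //; apply: fB.
    exact: sub_sigma_algebra.
exists G0; split=> // U U' GU GU' x x' Ux U'x' Xx Xx'.
have /fE[a [b [aU bU' Eab]]] := G0f U U' GU GU'.
have [Xa Xb] := EX _ _ Eab.
have Exa : E x a by apply: E_model => //; rewrite (rP U x).
apply: (Etrans _ _ _ Exa); apply: (Etrans _ _ _ Eab).
by apply: E_model => //; rewrite (rP U' x').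
Qed.

Context {Phi : nat -> set (formula_over (C := C) set0 (sum_sort sg sg))}.
Hypothesis Phi_nf : normal_form R Phi X E.

(** The ultrafilters at distance at most [n] from [a], in the sense that [a] is at
    distance at most [n] from their realizations over [a]. *)
Definition near_point (n : nat) (a : tup C sg) : set S :=
  [set U | forall phi, Phi n phi -> sval U [set x | holds (pair_tup x a) phi]].

Lemma closed_near_point n a : closed (near_point n a).
Proof.
rewrite (_ : near_point n a = \bigcap_(phi in Phi n)
  [set U : S | sval U [set x | holds (pair_tup x a) phi]]) //.
by apply: closed_bigI => phi _; exact: closed_basic.
Qed.

Lemma near_pointP n a c (U : S) B : coords a `<=` B ->
  realizes_over B (sval U) c -> near_point n a U <-> solutions (Phi n) (pair_tup c a).
Proof.
move=> aB Uc.
have da (phi : formula_over (C := C) set0 (sum_sort sg sg)) :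
    definable B [set x : tup C sg | holds (pair_tup x a) phi].
  apply: (@definable_pair_right _ _ _ _ _ _ _ a [set u | holds u phi]) => //.
  by exists phi.
split=> [Un phi /Un|Hc phi /Hc].
  exact: (realizes_overP (S_ultra U) Uc (da phi)).1.
exact: (realizes_overP (S_ultra U) Uc (da phi)).2.
Qed.

Lemma near_point_pushes n a g (phi : S -> S) U : G g -> pushes (act g) phi ->
  near_point n (act g a) (phi U) <-> near_point n a U.
Proof.
move=> Gg gphi; have [Gaut _ _ _] := G_group.
have E1 (psi : formula_over (C := C) set0 (sum_sort sg sg)) :
    act g @^-1` [set x : tup C sg | holds (pair_tup x (act g a)) psi] =
    [set x | holds (pair_tup x a) psi].
  by apply/funext => x; apply/propext; apply: holds_pair_act; exact: Gaut.
split=> Un psi Ppsi.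
  by have /gphi := Un psi Ppsi; rewrite E1.
by apply/gphi; rewrite E1; exact: Un.
Qed.

(** If comeagerly many ultrafilters are at finite distance from [c0], Baire
    category gives an open set of ultrafilters at distance at most [n], finitely
    many translates of it cover the flow, and every ultrafilter of the flow is
    at a bounded distance from [c0]. *)
Lemma flow_near_point (G0 : set S) (c0 : tup C sg) : meager (~` G0) ->
  X c0 -> tp set0 c0 = tp set0 d0 ->
  (forall U, G0 U -> exists n, near_point n c0 U) ->
  exists n, forall U, near_point n c0 U.
Proof.
move=> mG0 Xc0 c0d0 G0near.
have Sfip : fip (E d0 |` P) by case: P_invariant.
have [n [U0 U0n]] : exists n, (near_point n c0)° !=set0.
  apply: contrapT => nn; apply: (ultra_space_nonmeager Sfip).
  apply: (@meager_subset _ _ (~` G0 `|` \bigcup_n near_point n c0)).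
    move=> U _; have [/G0near[n Un]|] := pselect (G0 U); last by left.
    by right; exists n.
  apply: meagerU => //; apply: meager_bigcup => // n _.
  apply: nowhere_dense_meager; apply: closed_interior0_nowhere_dense.
    exact: closed_near_point.
  by rewrite -subset0 => U Un; apply: nn; exists n, U.
have [_ Scov] := minimal_flow_minimal H_id H_comp H_inv H_D P_invariant P_maximal.
have [F [finF FH Fcov]] := Scov _ (open_interior _) (ex_intro _ U0 U0n).
(* [m] bounds the distances from [c0] to its images under the inverses of the finitely
   many group elements inducing the maps in [F]. *)
have [m mP] : exists m, forall phi, F phi -> forall U, near_point n c0 (phi U) ->
    exists2 c1, near_point n c1 U & solutions (Phi m) (pair_tup c1 c0).
  move: F finF FH {Fcov}; apply: finite_set_ind => [_|phi F IH FH]; first by exists 0%N.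
  have [|m mP] := IH; first by move=> x Fx; apply: FH; right.
  have [_ [g Gg <-] gphi] := FH phi (or_introl erefl).
  have [g' [Gg' gK g'K]] := group_inverse Gg.
  have [EX _ Esym _] := E_equivalence; have [_ _ _ nfE _] := Phi_nf.
  have Ec1 := Esym _ _ (G_class Xc0 c0d0 Gg'); have [Xc1 _] := EX _ _ Ec1.
  have [k Hk] := (nfE _ _ Xc1 Xc0).1 Ec1.
  exists (maxn m k) => x [->|Fx] U.
    rewrite -{1}(g'K c0) => /(near_point_pushes _ _ _ Gg gphi) Un.
    exists (act g' c0) => //; apply: nf_mono Hk; [exact: Phi_nf|exact: leq_maxr].
  move=> /(mP x Fx)[c1 Uc1 Hc1]; exists c1 => //.
  by apply: nf_mono Hc1; [exact: Phi_nf|exact: leq_maxl].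
exists (n + m)%N => U; have [phi Fphi phiU] := Fcov U.
have [c1 Uc1 Hc1] := mP phi Fphi U (interior_subset phiU).
have [|c [Uc _ _]] := @flow_realize (coords c1 `|` coords c0) U.
  by apply: countable_setU; exact: countable_coords.
apply/(near_pointP (B := coords c1 `|` coords c0) _ _ Uc); first by move=> x; right.
apply: nf_trans Hc1; first exact: Phi_nf.
by apply/(near_pointP (B := coords c1 `|` coords c0) _ _ Uc) => // x; left.
Qed.

(** A flow at distance at most [n] from [c0] is, by its invariance and the
    transitivity of the group, at distance at most [n] from every point of the
    class of [c0]. *)
Lemma flow_class_bounded n (c0 : tup C sg) : tp set0 c0 = tp set0 d0 ->
  (forall U : S, near_point n c0 U) ->
  forall a b, E c0 a -> E c0 b -> solutions (Phi (n + n)%N) (pair_tup a b).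
Proof.
move=> c0d0 near a b Ea Eb.
have near_class d : E c0 d -> forall U : S, near_point n d U.
  move=> Ed U; have [g Gg <-] := G_transitive c0d0 Ed.
  have [g' [Gg' gK g'K]] := group_inverse Gg.
  have [phi gphi] : exists phi : S -> S, pushes (act g') phi.
    by apply: (pushes_exists H_D P_invariant); exists g'.
  apply/(near_point_pushes _ _ _ Gg' gphi); rewrite gK; exact: near.
have Sfip : fip (E d0 |` P) by case: P_invariant.
have [U [UU QU]] := fip_ultrafilter Sfip.
pose U' : S := exist _ U (conj UU QU).
have [|c [Uc _ _]] := @flow_realize (coords a `|` coords b) U'.
  by apply: countable_setU; exact: countable_coords.
apply: (nf_trans Phi_nf (b := c)).
  apply: nf_sym; first exact: Phi_nf.
  apply/(near_pointP (B := coords a `|` coords b) _ _ Uc); first by move=> x; left.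
  exact: near_class.
apply/(near_pointP (B := coords a `|` coords b) _ _ Uc); first by move=> x; right.
exact: near_class.
Qed.

End Flow.

Lemma smooth_class_diameter_finite
    (Phi : nat -> set (formula_over set0 (sum_sort sg sg))) :
  normal_form R Phi X E -> smooth_restr R E Y ->
  exists n, (diameter R Phi (E d0) <= n%:R%:E)%E.
Proof.
move=> Phi_nf [M [Mel Mc [PT [PTp [f fB fE]]]]].
have [EX Erefl Esym Etrans] := E_equivalence.
have [|P [P_invariant P_maximal]] := @maximal_invariant_fip _ H (E d0).
  by exists d0; exact: Erefl.
have [G0 [mG0 G0E]] := flow_comeager_rel P_invariant P_maximal Mel Mc PTp fB fE.
have Sfip : fip (E d0 |` P) by case: P_invariant.
have [U0 GU0] : G0 !=set0.
  apply: contrapT => /set0P/negP/negPn/eqP G00; apply: (ultra_space_nonmeager Sfip).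
  by move: mG0; rewrite G00 setC0.
have [c0 [Uc0 Yc0 c0d0]] := flow_realize U0 Mc.
have Xc0 := Y_sub Yc0.
have [_ _ _ nfE _] := Phi_nf.
have [n nP] : exists n, forall U, near_point (Phi := Phi) (P := P) n c0 U.
  apply: (flow_near_point P_invariant P_maximal Phi_nf mG0) => // U GU.
  have [|c [Uc Yc _]] := @flow_realize P (M `|` coords c0) U.
    by apply: countable_setU => //; exact: countable_coords.
  have Ecc0 : E c c0.
    apply: (G0E U U0) => //; last exact: Y_sub.
    by apply: realizes_overS Uc => x; left.
  have [k Hk] := (nfE _ _ (Y_sub Yc) Xc0).1 Ecc0; exists k.
  by apply/(near_pointP (B := M `|` coords c0) _ _ Uc) => // x; right.
(* The class of [c0] is bounded, and conjugate to the class of [d0]. *)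
have bnd := flow_class_bounded P_invariant Phi_nf c0d0 nP.
have sI : small K [set: I] by exact: small_countable.
have [s auts sd0] := C_homogeneous sI (esym c0d0).
exists (n + n)%N; apply: (nf_diameter_le Phi_nf) => a b Ea Eb phi Pphi.
apply/(holds_pair_act phi a b auts); apply: bnd Pphi.
  by rewrite -sd0; apply: rel_act.
by rewrite -sd0; apply: rel_act.
Qed.

End OrbitalClass.

Local Open Scope ereal_scope.

Theorem theorem3p2 (R : realType) (L : language) (T : set (sentence L))
  (K : Type) (C : structure L)
  (I : Type) (sg : I -> lsort L)
  (X : set (tup C sg)) (E : tup C sg -> set (tup C sg))
  (Y : set (tup C sg)) (D : set (tup C sg))
  (L_countable : countable_language L)
  (T_complete : complete_theory T)
  (T_infinite : has_infinite_model T)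
  (C_model : model_of T C)
  (C_monster : monster C K)
  (X_type_definable : type_definable X)
  (X_countably_supported : countable [set: I])
  (E_equivalence : equivalence_on X E)
  (E_bounded : bounded_rel K X E)
  (E_Fsigma : Fsigma_rel E)
  (E_orbital : orbital_on_types X E)
  (Y_sub : Y `<=` X)
  (Y_pseudo_closed : pseudo_closed K Y)
  (Y_saturated : rel_saturated E Y)
  (D_class : classes X E D)
  (D_sub : D `<=` Y)
  (D_diameter : exists Phi : nat -> set (formula_over set0 (sum_sort sg sg)),
     normal_form R Phi X E /\ diameter R Phi D = +oo) :
  ~ smooth_restr R E Y.
Proof.
have [d0 Xd0 D_E] := D_class; case: _ / D_E in D_class D_sub D_diameter *.
have [Phi [Phi_nf Phi_diameter]] := D_diameter.
have [K_large C_saturated C_homogeneous] := C_monster.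
have [E_tp E_orb] := E_orbital; have [E_invariant _] := E_Fsigma.
have [EX Erefl Esym Etrans] := E_equivalence.
have [|G [G_group G_stable G_transitive]] := E_orb (tp set0 d0); first by exists d0.
have classE a : X a -> tp set0 a = tp set0 d0 ->
    classes [set x | tp set0 x = tp set0 d0]
      (restr [set x | tp set0 x = tp set0 d0] E) (E a).
  move=> Xa ad0; exists a => //; apply/seteqP; split=> b /=; first by case.
  by move=> Eab; split=> //; rewrite /= -(E_tp _ _ Eab).
move=> smoothE.
have [] := @smooth_class_diameter_finite R L C K K_large C_saturated C_homogeneous
  I sg X_countably_supported X E Y X_type_definable E_equivalence E_bounded
  E_invariant Y_sub Y_pseudo_closed d0 D_sub E_tp G G_group _ _ Xd0 Phi Phi_nf smoothE.
- move=> g a Xa ad0 Gg; have <- := G_stable _ _ (classE a Xa ad0) Gg.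
  by exists a => //; exact: Erefl.
- move=> a b ad0 Eab; have [Xa _] := EX _ _ Eab.
  apply: (G_transitive _ _ _ (classE a Xa ad0)) => //; exact: Erefl.
- by move=> n; rewrite Phi_diameter leye_eq.
Qed.
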